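(* Let $(\mathcal V,F)$ be a Randers-Minkowski space with Zermelo data $(h,W)$ and let $\Sigma=\{x\in\mathcal V:F(x)=1\}$ be its indicatrix. The flag curvature $K_v(u)$ of $(\Sigma,F|_\Sigma)$ at $x\in\Sigma$ is given by $$\begin{aligned} K_v(u)=\frac{1}{1-h(N_x,W)^2}\Big[&h(\tfrac{v}{F(v)},\tfrac{v}{F(v)})-h(\tfrac{\tilde u}{|\tilde u|_h},\tfrac{v}{F(v)})^2\\ &+\frac{h(v,v)}{2F(v)^3(1-h(N_x,W)^2)}\Big(-h(v,W)\big(1+3h(N_x,W)^2\big)+\frac{3}{2F(v)}h(N_x,W)^2h(v,v)\Big)\Big], \end{aligned}$$ where $v\in T_x\Sigma\setminus\{0\}$, $u\in T_x\Sigma$ is linearly independent of $v$, $\phi(v)=h(v/F(v)-W,v/F(v))$, $\tilde u=u-\frac1{\phi(v)}h(v/F(v)-W,u)\frac{v}{F(v)}$ and $N_x=-(x-W)$.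
   Context: Randers norm and Zermelo data: $\mathcal V$ is a finite-dimensional real vector space, $h$ a positive definite scalar product on $\mathcal V$, $W\in\mathcal V$ with $h(W,W)<1$, and $F:\mathcal V\to[0,\infty)$ is determined by $F(0)=0$ and $F(v)>0$, $h(\frac{v}{F(v)}-W,\frac{v}{F(v)}-W)=1$ for $v\neq0$. $(\mathcal V,F)$ is called a Randers-Minkowski space with Zermelo data $(h,W)$. Set $|y|_h^2=h(y,y)$. Tangent spaces of $\mathcal V$ are identified with $\mathcal V$, so $F(v)$, $h(v,\cdot)$ make sense for $v\in T_x\Sigma\subset\mathcal V$; $F|_\Sigma$ is the restriction of $F$ to $T\Sigma$, a Finsler metric on the hypersurface $\Sigma$. Flag curvature of $(S,F|_S)$ with $S=\Sigma$: put $L=(F|_S)^2$ on $TS\setminus\mathbf 0$, $g_v(u,w)=\frac12\frac{\partial^2}{\partial s\partial t}L(v+su+tw)|_{s=t=0}$ and $C_v(u,w,z)=\frac12\frac{\partial}{\partial t}g_{v+tz}(u,w)|_{t=0}$. The Levi-Civita-Chern connection is the unique map $(v,X,Y)\mapsto\nabla^v_XY\in T_{\pi(v)}S$ ($\pi(v)$ the base point of $v$; depending smoothly on $v\in TS\setminus\mathbf 0$, for each $v$ having the usual additivity, tensoriality in $X$ and Leibniz rule in $Y$ of a linear connection at $\pi(v)$) such that, writing $\nabla^V$ for the affine connection $(\nabla^V_XY)_p=\nabla^{V_p}_XY$ defined by a nowhere zero local vector field $V$, one has $\nabla^V_XY-\nabla^V_YX=[X,Y]$ and $X(g_V(Y,Z))=g_V(\nabla^V_XY,Z)+g_V(Y,\nabla^V_XZ)+2C_V(\nabla^V_XV,Y,Z)$.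 Let $P_v(X,Y,Z)=\frac{\partial}{\partial t}\nabla^{v+tZ}_XY|_{t=0}$. Its curvature is $R_v(X,Y)Z=R^V(X,Y)Z|_{\pi(v)}-P_v(Y,Z,\nabla^V_XV)+P_v(X,Z,\nabla^V_YV)$, where $V$ is any local extension of $v$ and $R^V(X,Y)Z=\nabla^V_X\nabla^V_YZ-\nabla^V_Y\nabla^V_XZ-\nabla^V_{[X,Y]}Z$ (the result does not depend on $V$). The flag curvature is $K_v(u)=\dfrac{g_v(R_v(v,u)u,v)}{L(v)g_v(u,u)-g_v(u,v)^2}$ for $u$ linearly independent of $v$. *)

(* Defs.v *)
From HB Require Import structures.
From mathcomp Require Import all_boot all_order all_algebra.
From mathcomp Require Import sesquilinear.
From mathcomp Require Import all_classical all_reals all_analysis.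

Set Implicit Arguments.
Unset Strict Implicit.
Unset Printing Implicit Defensive.

Import Order.TTheory GRing.Theory Num.Theory.
Import numFieldNormedType.Exports.

Local Open Scope classical_set_scope.
Local Open Scope ring_scope.

Definition finite_dimensional (R : realType) (V : normedModType R) : Prop :=
  exists (n : nat) (e : 'I_n -> V),
    forall x : V, exists c : 'I_n -> R, x = \sum_(i < n) c i *: e i.

(* On a finite-dimensional space this is the usual class C^k: iterated
   derivatives along constant vectors, up to order k, exist (the first ones in
   the sense of Frechet) and are continuous on U. *)
Fixpoint Ck (R : realType) (V E : normedModType R) (k : nat) (U : set V)
    (f : V -> E) : Prop :=
  match k with
  | 0 => forall x, U x -> {for x, continuous f}
  | k'.+1 => (forall x, U x -> differentiable f x) /\
             forall v : V, Ck k' U (fun x => 'D_v f x)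
  end.

Definition smooth_at (R : realType) (V E : normedModType R) (f : V -> E)
    (p : V) : Prop :=
  exists U : set V, [/\ open U, U p & forall k, Ck k U f].

(* A function on a submanifold S of V is represented by a function on V whose
   values off S are irrelevant; it is smooth near p when, near p, it coincides
   on S with a smooth function of the ambient space. *)
Definition smooth_along (R : realType) (V E : normedModType R) (S : set V)
    (f : V -> E) (p : V) : Prop :=
  exists g : V -> E, smooth_at g p /\ \forall q \near p, S q -> f q = g q.

Section Submanifold.
Context (R : realType) (V : normedModType R) (S : set V).

Definition curve_through (p v : V) (c : R -> V) : Prop :=
  [/\ smooth_at (c : R^o -> V) 0, \forall t \near (0 : R), S (c t),
      c 0 = p & derive1 c 0 = v].

Definition tangent (p : V) : set V := [set v | exists c, curve_through p v c].

Definition tangent_bundle : set (V * V) := [set z | S z.1 /\ tangent z.1 z.2].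

(* The derivative v(f) at p of a function f on S: the derivative of f along a
   curve of S representing v.  For f smooth along S at p it does not depend on
   the curve that [get] selects. *)
Definition tderive (E : normedModType R) (f : V -> E) (p v : V) : E :=
  derive1 (f \o get (curve_through p v)) 0.

Definition vfield_near (p : V) (X : V -> V) : Prop :=
  smooth_along S X p /\ \forall q \near p, S q -> tangent q (X q).

Definition local_extension (p v : V) (X : V -> V) : Prop :=
  vfield_near p X /\ X p = v.

Definition bracket (X Y : V -> V) (p : V) : V :=
  tderive Y p (X p) - tderive X p (Y p).

End Submanifold.

Section FundamentalTensor.
Context (R : realType) (V : normedModType R) (L : V -> R).

Definition fund_tensor (v u w : V) : R :=
  2^-1 * derive1 (fun s : R => derive1 (fun t : R => L (v + s *: u + t *: w)) 0) 0.

Definition cartan_tensor (v u w z : V) : R :=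
  2^-1 * derive1 (fun t : R => fund_tensor (v + t *: z) u w) 0.

End FundamentalTensor.

(* nabla p v X Y stands for nabla^v_X Y at the base point p of v in T_p S; it
   is only constrained for nonzero v tangent to S at p and for fields X, Y
   defined (on S) near p. *)
Definition anisotropic_connection (R : realType) (V : normedModType R) :=
  V -> V -> (V -> V) -> (V -> V) -> V.

Section Connection.
Context (R : realType) (V : normedModType R).
(* L v is the square of the Finsler metric of S on tangent vectors v; the
   metrics considered here are restrictions to TS of a function on V, so L does
   not depend on the base point. *)
Context (S : set V) (L : V -> R) (nabla : anisotropic_connection V).

Local Notation g := (fund_tensor L).
Local Notation C := (cartan_tensor L).

Definition aconn (A X Y : V -> V) : V -> V := fun q => nabla q (A q) X Y.

Record levi_civita_chern : Prop := {
  lcc_tangent : forall p v X Y, S p -> tangent S p v -> v != 0 ->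
    vfield_near S p X -> vfield_near S p Y -> tangent S p (nabla p v X Y);
  lcc_smooth : forall p v X Y, S p -> tangent S p v -> v != 0 ->
    vfield_near S p X -> vfield_near S p Y ->
    smooth_along (tangent_bundle S) (fun z : V * V => nabla z.1 z.2 X Y)
      (p, v);
  lcc_addl : forall p v X X' Y, S p -> tangent S p v -> v != 0 ->
    vfield_near S p X -> vfield_near S p X' -> vfield_near S p Y ->
    nabla p v (X + X') Y = nabla p v X Y + nabla p v X' Y;
  lcc_tensorial : forall p v (f : V -> R^o) X Y,
    S p -> tangent S p v -> v != 0 -> smooth_along S f p ->
    vfield_near S p X -> vfield_near S p Y ->
    nabla p v (fun q => f q *: X q) Y = f p *: nabla p v X Y;
  lcc_addr : forall p v X Y Y', S p -> tangent S p v -> v != 0 ->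
    vfield_near S p X -> vfield_near S p Y -> vfield_near S p Y' ->
    nabla p v X (Y + Y') = nabla p v X Y + nabla p v X Y';
  lcc_leibniz : forall p v (f : V -> R^o) X Y,
    S p -> tangent S p v -> v != 0 -> smooth_along S f p ->
    vfield_near S p X -> vfield_near S p Y ->
    nabla p v X (fun q => f q *: Y q) =
      tderive S f p (X p) *: Y p + f p *: nabla p v X Y;
  lcc_torsion_free : forall p A X Y, S p -> vfield_near S p A -> A p != 0 ->
    vfield_near S p X -> vfield_near S p Y ->
    aconn A X Y p - aconn A Y X p = bracket S X Y p;
  lcc_almost_metric : forall p A X Y Z,
    S p -> vfield_near S p A -> A p != 0 ->
    vfield_near S p X -> vfield_near S p Y -> vfield_near S p Z ->
    tderive S (fun q => g (A q) (Y q) (Z q) : R^o) p (X p) =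
      g (A p) (aconn A X Y p) (Z p) + g (A p) (Y p) (aconn A X Z p)
      + 2 * C (A p) (aconn A X A p) (Y p) (Z p)
}.

(* Derivative in the vertical direction z of v |-> nabla^v_X Y. *)
Definition vertical_derivative (p v : V) (X Y : V -> V) (z : V) : V :=
  derive1 (fun t : R => nabla p (v + t *: z) X Y) 0.

Definition affine_curvature (A X Y Z : V -> V) (p : V) : V :=
  aconn A X (aconn A Y Z) p - aconn A Y (aconn A X Z) p
  - aconn A (bracket S X Y) Z p.

Definition chern_curvature (A X Y Z : V -> V) (p : V) : V :=
  affine_curvature A X Y Z p
  - vertical_derivative p (A p) Y Z (aconn A X A p)
  + vertical_derivative p (A p) X Z (aconn A Y A p).

(* k is the flag curvature K_v(u) at p: extensions A, X of v and Y, Z of u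
   exist, and evaluating R_v(v, u)u with any of them gives k. *)
Definition is_flag_curvature (p v u : V) (k : R) : Prop :=
  [/\ exists A, local_extension S p v A,
      exists Y, local_extension S p u Y &
      forall A X Y Z : V -> V,
        local_extension S p v A -> local_extension S p v X ->
        local_extension S p u Y -> local_extension S p u Z ->
        k = g v (chern_curvature A X Y Z p) v
            / (L v * g v u u - (g v u v) ^+ 2)].

End Connection.

Section RandersMinkowski.
Context (R : realType) (V : normedModType R) (h : {dot V for idfun}) (W : V).

Definition zermelo_norm (F : V -> R) : Prop :=
  F 0 = 0 /\
  forall v, v != 0 ->
    0 < F v /\ h ((F v)^-1 *: v - W) ((F v)^-1 *: v - W) = 1.

Definition indicatrix (F : V -> R) : set V := [set x | F x = 1].

Definition hnorm (y : V) : R := Num.sqrt (h y y).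

Definition Nvec (x : V) : V := - (x - W).

Definition phi (F : V -> R) (v : V) : R :=
  h ((F v)^-1 *: v - W) ((F v)^-1 *: v).

Definition tilde (F : V -> R) (v u : V) : V :=
  u - ((phi F v)^-1 * h ((F v)^-1 *: v - W) u) *: ((F v)^-1 *: v).

End RandersMinkowski.

(* Main.v *)
Require Import Defs.
From HB Require Import structures.
From mathcomp Require Import all_boot all_order all_algebra.
From mathcomp Require Import sesquilinear.
From mathcomp Require Import all_classical all_reals all_analysis.
From mathcomp Require Import ring lra.
Set Implicit Arguments.
Unset Strict Implicit.
Unset Printing Implicit Defensive.
Import Order.TTheory GRing.Theory Num.Theory.
Import numFieldNormedType.Exports.
Local Open Scope classical_set_scope.
Local Open Scope ring_scope.

(** The indicatrix is the unit [h]-sphere around [W], so it sits in the flat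
    ambient space.  Write [nabla^v_X Y = D_X Y + E_v(X, Y)] with [D] the ambient
    derivative.  Torsion-freeness makes [E_v] symmetric, tangency prescribes
    [h(N, E_v(X, Y)) = - h(X, Y)], and almost metricity then gives, by the Koszul
    trick, [E_v(v, v) = - h(v, v) nu], [E_v(X, v)] and [g_v(v, E_v(Y, Z))]
    explicitly, where [nu] is the [g_v]-normal with [h(N, nu) = 1].  Pairing the
    curvature with [v], the second derivatives [D_X D_Y Z] cancel by Schwarz'
    theorem and only derivatives of the explicit form [g_v(v, E_v(Y, Z))] remain.
    Since [F] solves [(1 - h(W, W)) F(v)^2 + 2 h(v, W) F(v) = h(v, v)], all of this
    is rational in [F(v)] and the values of [h]. *)

(** * Dot products in finite dimension *)

(** No closed form of [E_v(Y, Z)] is computed when neither argument extends [v]. In the curvature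
    paired with [v] such a value survives only in [g_v(E_v(v, v), E_v(u, u))]. As [E_v(v, v)] is a
    multiple of [nu], this product sees only the [h]-normal component of [E_v(u, u)], which tangency
    prescribes. The flat derivative [D] satisfies almost metricity by itself, because [C_v] is half
    the [v]-derivative of [g_v]. Subtracting it leaves an algebraic identity for [E_v], free of
    derivatives of the fields. All closed forms are written for arbitrary ambient vectors: a tangent
    vector such as [nabla_X A] is split into [D_X A] and [E_v(X, A)], which need not be tangent. The
    axioms speak of fields near a point, so covariant derivatives and brackets must be shown to be
    smooth and tangent before an axiom applies to them. The norm of [V] is unrelated to [h]; finite
    dimension links the two. Since [Ck] differentiates along constant vectors, variable directions
    are expanded in an [h]-orthonormal basis. *)

Section DotProduct.
Context (R : realType) (V : normedModType R) (h : {dot V for idfun}).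
Implicit Types x y z : V.

Lemma dotC x y : h x y = h y x.
Proof. by rewrite hermC expr0 mul1r. Qed.

Lemma dot0l x : h 0 x = 0. Proof. exact: linear0l. Qed.
Lemma dot0r x : h x 0 = 0. Proof. by rewrite dotC dot0l. Qed.
Lemma dotDl x y z : h (x + y) z = h x z + h y z.
Proof. exact: linearDl. Qed.
Lemma dotDr x y z : h z (x + y) = h z x + h z y.
Proof. by rewrite !(dotC z) dotDl. Qed.
Lemma dotZl a x z : h (a *: x) z = a * h x z.
Proof. exact: linearZl_LR. Qed.
Lemma dotZr a x z : h z (a *: x) = a * h z x.
Proof. by rewrite !(dotC z) dotZl. Qed.
Lemma dotNl x z : h (- x) z = - h x z.
Proof. by rewrite -scaleN1r dotZl mulN1r. Qed.
Lemma dotNr x z : h z (- x) = - h z x.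
Proof. by rewrite !(dotC z) dotNl. Qed.
Definition dotE := (dotDl, dotDr, dotZl, dotZr, dotNl, dotNr, dot0l, dot0r).

Lemma dot_suml I (s : seq I) (P : pred I) (f : I -> V) z :
  h (\sum_(i <- s | P i) f i) z = \sum_(i <- s | P i) h (f i) z.
Proof.
by elim/big_rec2 : _ => [|i a b _ <-]; rewrite ?dot0l ?dotDl.
Qed.

Lemma dot_gt0 x : x != 0 -> 0 < h x x. Proof. exact: neq0_dnorm_gt0. Qed.

Lemma dot_ge0 x : 0 <= h x x.
Proof. by have [->|/dot_gt0/ltW//] := eqVneq x 0; rewrite dot0l. Qed.

Lemma dot_eq0 x : h x x = 0 -> x = 0.
Proof. by move=> x0; apply/eqP/negPn/negP => /dot_gt0; rewrite x0 ltxx. Qed.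

Lemma CauchySchwarz_dot x y : h x y ^+ 2 <= h x x * h y y.
Proof.
have [->|y0] := eqVneq y 0; first by rewrite !dot0r expr0n mulr0.
have := dot_ge0 (h y y *: x - h x y *: y); rewrite !dotE (dotC y x).
have -> : h y y * (h y y * h x x) - h y y * (h x y * h x y) -
  (h x y * (h y y * h x y) - h x y * (h x y * h y y)) =
  h y y * (h x x * h y y - h x y ^+ 2) by ring.
by rewrite pmulr_rge0 ?dot_gt0// subr_ge0.
Qed.

(** Gram-Schmidt on a spanning family that need not be free: a vanishing residue [r] adds no basis
    vector. *)
Lemma orthonormal_basis : finite_dimensional V ->
  exists (n : nat) (e : 'I_n -> V),
    (forall i j, h (e i) (e j) = (i == j)%:R) /\
    forall x, x = \sum_(i < n) h x (e i) *: e i.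
Proof.
move=> [n [e span_e]].
(* Asking only that the family [e] expand in [b], not all of [V], makes the statement pass to
   subfamilies, so induction on [n] applies. *)
suff [m [b [bb eb]]] : exists m (b : 'I_m -> V),
    (forall i j, h (b i) (b j) = (i == j)%:R) /\
    forall j, e j = \sum_(i < m) h (e j) (b i) *: b i.
  exists m, b; split=> // x; have [c ->] := span_e x.
  under [RHS]eq_bigr do rewrite dot_suml scaler_suml.
  rewrite exchange_big/=; apply: eq_bigr => j _.
  under eq_bigr do rewrite dotZl -scalerA.
  by rewrite -scaler_sumr -eb.
elim: n e {span_e} => [|n IHn] e.
  by exists 0%N, e; split=> [] [].
have [m [b [bb eb]]] := IHn (fun i => e (lift ord0 i)).
pose r := e ord0 - \sum_(i < m) h (e ord0) (b i) *: b i.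
have e0 : e ord0 = r + \sum_(i < m) h (e ord0) (b i) *: b i by rewrite subrK.
have rb i : h r (b i) = 0.
  rewrite /r dotDl dotNl dot_suml (bigD1 i)//= dotZl bb eqxx mulr1 big1 ?addr0
    ?subrr//.
  by move=> j /negPf ji; rewrite dotZl bb ji mulr0.
have [r0|r0] := eqVneq r 0.
  exists m, b; split=> // j; case: (unliftP ord0 j) => [k ->//|->].
  by rewrite {1}e0 r0 add0r.
clearbody r; have q0 := dot_gt0 r0; set q := h r r in q0.
pose u := (Num.sqrt q)^-1 *: r.
have uu : h u u = 1.
  rewrite /u dotZl dotZr -/q mulrA -invfM -expr2 sqr_sqrtr ?ltW//.
  by rewrite mulVf ?gt_eqF.
have ub i : h u (b i) = 0 by rewrite /u dotZl rb mulr0.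
pose b' (i : 'I_m.+1) := if unlift ord0 i is Some k then b k else u.
have b'0 : b' ord0 = u by rewrite /b' unlift_none.
have b'S k : b' (lift ord0 k) = b k by rewrite /b' liftK.
exists m.+1, b'; split=> [i j|j].
  case: (unliftP ord0 i) => [k ->|->]; case: (unliftP ord0 j) => [l ->|->].
  - by rewrite !b'S bb (inj_eq lift_inj).
  - by rewrite b'S b'0 dotC ub eq_sym (negPf (neq_lift _ _)).
  - by rewrite b'S b'0 ub (negPf (neq_lift _ _)).
  - by rewrite b'0 uu eqxx.
rewrite big_ord_recl b'0; under eq_bigr do rewrite b'S.
case: (unliftP ord0 j) => [k ->|->].
  have -> : h (e (lift ord0 k)) u = 0.
    rewrite eb dot_suml big1// => i _.
    by rewrite dotZl [h _ u]dotC ub mulr0.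
  by rewrite scale0r add0r -eb.
rewrite [LHS]e0; congr (_ + _).
rewrite e0 dotDl dot_suml big1 ?addr0; last first.
  by move=> i _; rewrite dotZl [h _ u]dotC ub mulr0.
rewrite /u dotZr -/q scalerA -mulrA mulrC -mulrA -invfM -expr2.
by rewrite sqr_sqrtr ?ltW// mulfV ?gt_eqF// scale1r.
Qed.

End DotProduct.

(** * Continuity and differentiability of the dot product *)

Section DotContinuity.
Context (R : realType) (V : normedModType R) (h : {dot V for idfun}).
Hypothesis fdV : finite_dimensional V.

(** Equivalence of norms: the coordinate map [T] is continuous and injective, so the norm of [T r]
    has a positive minimum on the compact unit sphere of row vectors, and the inverse of that
    minimum serves as [K]. *)
Lemma coord_bound n (e : 'I_n -> V) :
  (forall i j, h (e i) (e j) = (i == j)%:R) ->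
  (forall x, x = \sum_(i < n) h x (e i) *: e i) ->
  exists2 K, 0 < K & forall x i, `|h x (e i)| <= K * `|x|.
Proof.
move=> ee eb.
pose T (r : 'rV[R]_n) : V := \sum_(i < n) r ord0 i *: e i.
have TE x : T (\row_i h x (e i)) = x.
  by rewrite [RHS]eb; apply: eq_bigr => i _; rewrite mxE.
have coordT r i : h (T r) (e i) = r ord0 i.
  rewrite dot_suml (bigD1 i)//= dotZl ee eqxx mulr1 big1 ?addr0// => j /negPf ji.
  by rewrite dotZl ee ji mulr0.
have TZ a r : T (a *: r) = a *: T r.
  by rewrite scaler_sumr; apply: eq_bigr => i _; rewrite mxE scalerA.
have cT : continuous T.
  move=> r; apply: (@continuous_big _ _ _ _ _ _ _ _
    (fun i (r : 'rV[R]_n) => r ord0 i *: e i)) => [|i _ x].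
    exact: add_continuous.
  apply: (@continuous_comp _ _ _ (fun r : 'rV[R]_n =>
    r ord0 i : R) (fun k : R => k *: e i)).
    exact: coord_continuous.
  exact: scalel_continuous.
pose S := [set r : 'rV[R]_n | `|r| = 1].
have rS (r : 'rV[R]_n) : r != 0 -> S (`|r|^-1 *: r).
  by move=> r0; rewrite /S/= normrZ normfV normr_id mulVf// normr_eq0.
have le_coord (r : 'rV[R]_n) i : `|r ord0 i| <= `|r|.
  rewrite [leRHS]/Num.norm/= mx_normrE.
  by rewrite (le_trans _ (le_bigmax _ _ (ord0, i))).
(* An empty sphere leaves only the zero row, so all coordinates vanish and any [K] works. *)
have [[s Ss]|S0] := pselect (S !=set0); last first.
  exists 1 => // x i; rewrite mul1r.
  have -> : h x (e i) = 0; last by rewrite normr0.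
  have [r0|/rS Sr] := eqVneq (\row_i h x (e i)) 0; last by case: S0;
    exists (`|\row_i h x (e i)|^-1 *: \row_i h x (e i)).
  by have /rowP/(_ i) := r0; rewrite !mxE.
have cS : compact S.
  apply: bounded_closed_compact.
    by exists 1; split => // M M1 r /= ->; exact: ltW.
  rewrite (_ : S = (fun r : 'rV[R]_n => `|r|) @^-1` [set 1])//.
  by apply: preimage_closed => [r _|]; [exact: norm_continuous|exact: closed_eq].
have [|c Sc minc] := @EVT_min_rV R n (fun r => `|T r|) S (ex_intro _ s Ss) cS.
  apply: continuous_subspaceT => r.
  by apply: continuous_comp; [exact: cT|exact: norm_continuous].
move: Sc; rewrite inE => Sc.
have Tc0 : 0 < `|T c|.
  rewrite normr_gt0; apply/eqP => Tc.
  have c0 : c = 0 by apply/rowP => i; rewrite -coordT Tc dot0l mxE.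
  by move: Sc; rewrite /S/= c0 normr0 => /esym/eqP; rewrite oner_eq0.
exists (`|T c|^-1) => [|x i]; first by rewrite invr_gt0.
set r := \row_i h x (e i).
have -> : h x (e i) = r ord0 i by rewrite mxE.
apply: le_trans (le_coord r i) _.
have [->|r0] := eqVneq r 0; first by rewrite normr0 mulr_ge0// invr_ge0.
rewrite ler_pdivlMl// -[in leRHS](TE x) -/r.
have := minc _ (mem_set (rS r r0)); rewrite TZ normrZ normfV normr_id.
by rewrite ler_pdivlMl ?normr_gt0// mulrC.
Qed.

Lemma dot_bound : exists2 K, 0 < K & forall x y, `|h x y| <= K * `|x| * `|y|.
Proof.
have [n [e [ee eb]]] := orthonormal_basis h fdV.
have [K K0 Kb] := coord_bound ee eb.
(* The summand 1 keeps the constant positive when [n] is 0. *)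
exists (n%:R * (K * K) + 1) => [|x y]; first by rewrite ltr_wpDl// mulr_ge0//
  mulr_ge0 ?ltW.
rewrite {1}(eb x) dot_suml (le_trans (ler_norm_sum _ _ _))//.
have : \sum_(i < n) `|h (h x (e i) *: e i) y| <= \sum_(i < n) (K * K) * `|x| * `|y|.
  apply: ler_sum => i _; rewrite dotZl normrM [h _ y]dotC.
  rewrite (_ : _ * `|y| = (K * `|x|) * (K * `|y|)); last by ring.
  by rewrite ler_pM.
move=> /le_trans; apply; rewrite sumr_const card_ord -mulr_natl.
rewrite -subr_ge0 (_ : _ - _ = `|x| * `|y|) ?mulr_ge0//; ring.
Qed.

Lemma dot_continuous_l y : continuous (fun x => h x y : R).
Proof.
have [K K0 Kb] := dot_bound.
move=> x; apply/cvgrPdist_lt => e e0; near=> z.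
rewrite -dotNl -dotDl (le_lt_trans (Kb _ _))//.
rewrite (@le_lt_trans _ _ (K * (`|y| + 1) * `|x - z|))//.
  rewrite -!mulrA ler_pM2l// mulrC ler_wpM2r// lerDl//.
rewrite mulrC -ltr_pdivlMr ?mulr_gt0 ?ltr_wpDl//.
near: z; apply: cvgr_dist_lt; first exact: cvg_id.
by rewrite divr_gt0// mulr_gt0// ltr_wpDl.
Unshelve. all: by end_near. Qed.

(** In an orthonormal basis [h (a s) (b s)] is a finite sum of products of real functions, each a
    continuous linear form applied to [a] or [b]; the scalar product rule then suffices. *)
Lemma is_derive_dot (U : normedModType R) (a b : U -> V) (t u : U) a' b' :
  is_derive t u a a' -> is_derive t u b b' ->
  is_derive t u (fun s => h (a s) (b s) : R) (h a' (b t) + h (a t) b').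
Proof.
have lin c c' y : is_derive t u c c' -> is_derive t u (fun s =>
  h (c s) y : R) (h c' y).
  move=> [dc dc']; have H : (fun k : R => k^-1 *: ((h^~ y \o c \o shift t)
    (k *: u) - h (c t) y)) @ 0^' --> h c' y.
    rewrite (_ : (fun k : R => _) = (h^~ y) \o (fun k : R =>
      k^-1 *: ((c \o shift t) (k *: u) - c t))).
      apply: cvg_comp; last exact: dot_continuous_l.
      by rewrite -dc'; exact: dc.
    by apply/funext => k /=; rewrite dotZl dotDl dotNl.
  by split; [apply/cvg_ex; eexists; exact: H|exact: (cvg_lim _ H)].
have [n [e [ee eb]]] := orthonormal_basis h fdV.
have dotE x y : h x y = \sum_(i < n) h x (e i) * h y (e i).
  rewrite {1}(eb x) dot_suml; apply: eq_bigr => i _.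
  by rewrite dotZl [h (e i) y]dotC.
move=> da db.
rewrite (_ : (fun s => _) = \sum_(i < n) ((fun s => h (a s) (e i)) * (fun s =>
  h (b s) (e i))) :> (U -> R)); last first.
  by apply/funext => s; rewrite dotE fct_sumE; apply: eq_bigr.
have dai i := lin a a' (e i) da; have dbi i := lin b b' (e i) db.
apply: is_derive_eq.
rewrite [h a' _]dotE [h _ b']dotE -big_split/=; apply: eq_bigr => i _.
by rewrite addrC /GRing.scale/= [h (b t) _ * _]mulrC.
Qed.

End DotContinuity.

(** * Functions of class C^k *)

Section Derivatives.
Context (R : realType).
Implicit Types V E : normedModType R.

Lemma is_derive_comp_curve V E (f : V -> E) (c : R -> V) (t : R) (c' : V) :
  differentiable f (c t) -> is_derive t 1 c c' ->
  is_derive t 1 (f \o c) ('D_c' f (c t)).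
Proof.
move=> df [dc <-]; have dc1 : differentiable c t by apply/derivable1_diffP.
split; first by apply/derivable1_diffP; exact: differentiable_comp.
rewrite (deriveE _ (differentiable_comp dc1 df)) (diff_comp dc1 df)/=.
by rewrite (deriveE _ dc1) (deriveE _ df).
Qed.

Lemma is_derive_line V E (f : V -> E) (x u : V) (t : R) :
  differentiable f (x + t *: u) ->
  is_derive t 1 (fun s => f (x + s *: u)) ('D_u f (x + t *: u)).
Proof.
move=> df; apply: (@is_derive_comp_curve _ _ f (fun s => x + s *: u)) => //.
have -> : (fun s : R => x + s *: u) = cst x + ( *:%R ^~ u) by [].
apply: is_derive_eq; last exact: add0r.
apply: is_deriveD; split; first exact/diff_derivable.
by rewrite deriveE// diff_val scale1r.
Qed.

(** The differential of [f] also serves for [g], since the two remainders coincide near 0. *)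
Lemma near_eq_differentiable V E (f g : V -> E) (x : V) :
  (\near x, f x = g x) -> differentiable f x -> differentiable g x.
Proof.
move=> fg df; have gx := nbhs_singleton fg.
have [cdf /eqaddoP fE] := (diff_locallyP _ _).1 df.
have gE : g \o shift x = cst (g x) + 'd f x +o_ 0 id.
  apply/eqaddoP => e e0; have := fE e e0; apply: filter_app.
  have fg' : \forall y \near (0 : V), f (y + x) = g (y + x).
    by move: fg; rewrite (near_shift 0) /= subr0.
  apply: filterS fg' => y fgy.
  suff -> : (g \o shift x - (cst (g x) + 'd f x)) y =
      (f \o shift x - (cst (f x) + 'd f x)) y by [].
  by rewrite -[LHS]/(g (y + x) - (g x + 'd f x y)) -fgy -gx.
have dgE := diff_unique cdf gE.
by apply/diff_locallyP; split; rewrite dgE.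
Qed.

Lemma scale_is_bilinear V :
  bilinear_for (GRing.Scale.Law.clone _ _ *:%R _) (GRing.Scale.Law.clone _ _ *:%R _)
    (fun (a : R) (x : V) => a *: x).
Proof.
split=> [x a b c|a b x y] /=; first by rewrite scalerDl scalerA.
by rewrite scalerDr !scalerA mulrC.
Qed.

Lemma is_diff_scale V E (f : V -> R) (g : V -> E) (x : V) :
  differentiable f x -> differentiable g x ->
  differentiable (fun y => f y *: g y) x /\
  forall v, 'D_v (fun y => f y *: g y) x = 'D_v f x *: g x + f x *: 'D_v g x.
Proof.
move=> df dg.
pose bM := bilinear_isBilinear.Build R R E E _ _ (fun (a : R) (x : E) => a *: x)
  (scale_is_bilinear E).
pose b : {bilinear R -> E -> E} := HB.pack (fun (a : R) (x : E) => a *: x) bM.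
have cb : continuous (fun p : R * E => b p.1 p.2) by exact: scale_continuous.
have dp := differentiable_pair df dg.
have db := @differentiable_bilin R R E E b (f x, g x) cb.
have dfg := differentiable_comp dp db; split=> // v.
have dfx := deriveE v df; have dgx := deriveE v dg.
have := deriveE v dfg; rewrite (diff_comp dp db) => /= ->.
by rewrite (diff_bilin _ cb) (diff_pair df dg) -dfx -dgx /= addrC.
Qed.

Lemma is_diff_linear V E E' (L : E -> E') (f : V -> E) (x : V) :
  linear L -> continuous L -> differentiable f x ->
  differentiable (L \o f) x /\ forall v, 'D_v (L \o f) x = L ('D_v f x).
Proof.
move=> linL cL df.
pose LM := GRing.isLinear.Build _ _ _ _ _ linL.
pose LL : {linear E -> E'} := HB.pack L LM.
have cLL : continuous LL by [].
have dL := linear_differentiable (f x) cLL.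
have dLf := differentiable_comp df dL; split=> // v.
have := deriveE v dLf; rewrite (diff_comp df dL) => /= ->.
by rewrite (diff_lin _ cLL) (deriveE _ df).
Qed.

End Derivatives.

Section CkCalculus.
Context (R : realType).
Implicit Types V E : normedModType R.

Lemma Ck_ext V E k (U : set V) (f g : V -> E) : open U ->
  (forall x, U x -> f x = g x) -> Ck k U f -> Ck k U g.
Proof.
move=> oU; have nearU x (f' g' : V -> E) : U x -> (forall x, U x -> f' x = g' x) ->
    \near x, f' x = g' x.
  by move=> Ux fg'; apply: filterS (open_nbhs_nbhs (conj oU Ux)).
elim: k f g => [|k IHk] f g fg /=.
  move=> cf x Ux; suff : g y @[y --> x] --> f x by rewrite fg.
  by apply: cvg_trans (cf x Ux); apply: near_eq_cvg; exact: nearU.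
move=> [df Df]; split=> [x Ux|v].
  by apply: near_eq_differentiable (df x Ux); exact: nearU.
apply: IHk (Df v) => x Ux; apply: near_eq_derive; exact: nearU.
Qed.

Lemma CkW V E k (U : set V) (f : V -> E) : Ck k.+1 U f -> Ck k U f.
Proof.
elim: k f => [|k IHk] f /= [df Df].
  by move=> x Ux; apply: differentiable_continuous; exact: df.
by split=> // v; exact: IHk (Df v).
Qed.

Lemma Ck_subset V E k (U U' : set V) (f : V -> E) :
  U' `<=` U -> Ck k U f -> Ck k U' f.
Proof.
move=> UU'; elim: k f => [|k IHk] f /=; first by move=> cf x /UU'; exact: cf.
by move=> [df Df]; split=> [x /UU'/df//|v]; exact: IHk (Df v).
Qed.

Lemma Ck_cst V E k (U : set V) (a : E) : Ck k U (cst a : V -> E).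
Proof.
elim: k a => [|k IHk] a /=; first by move=> x _; exact: cst_continuous.
split=> [x _|v]; first exact: differentiable_cst.
rewrite (_ : (fun x => _) = cst 0); first exact: IHk.
by apply/funext => x; rewrite derive_cst.
Qed.

Lemma Ck_id V k (U : set V) : Ck k U (id : V -> V).
Proof.
case: k => [|k] /=; first by move=> x _; exact: cvg_id.
split=> [x _|v]; first exact: ex_diff.
rewrite (_ : (fun x => _) = cst v); first exact: Ck_cst.
by apply/funext => x; rewrite derive_id.
Qed.

Lemma CkD V E k (U : set V) (f g : V -> E) : open U ->
  Ck k U f -> Ck k U g -> Ck k U (f + g).
Proof.
move=> oU; elim: k f g => [|k IHk] f g /=.
  by move=> cf cg x Ux; apply: continuousD; [exact: cf|exact: cg].
move=> [df Df] [dg Dg]; split=> [x Ux|v].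
  by apply: differentiableD; [exact: df|exact: dg].
apply: (Ck_ext oU _ (IHk _ _ (Df v) (Dg v))) => x Ux /=.
by rewrite deriveD//; apply: diff_derivable; [exact: df|exact: dg].
Qed.

Lemma CkN V E k (U : set V) (f : V -> E) : open U -> Ck k U f -> Ck k U (- f).
Proof.
move=> oU; elim: k f => [|k IHk] f /=.
  by move=> cf x Ux; apply: continuousN; exact: cf.
move=> [df Df]; split=> [x Ux|v]; first by apply: differentiableN; exact: df.
apply: (Ck_ext oU _ (IHk _ (Df v))) => x Ux /=.
by rewrite deriveN//; apply: diff_derivable; exact: df.
Qed.

Lemma CkZ V E k (U : set V) (f : V -> R) (g : V -> E) : open U ->
  Ck k U f -> Ck k U g -> Ck k U (fun x => f x *: g x).
Proof.
move=> oU; elim: k f g => [|k IHk] f g Cf Cg.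
  by move=> x Ux; apply: cvgZ; [exact: Cf|exact: Cg].
have [df Df] := Cf; have [dg Dg] := Cg; split=> [x Ux|v].
  by have [] := is_diff_scale (df x Ux) (dg x Ux).
have C1 := CkD oU (IHk _ _ (Df v) (CkW Cg)) (IHk _ _ (CkW Cf) (Dg v)).
apply: (Ck_ext oU _ C1) => x Ux /=.
by have [_ ->] := is_diff_scale (df x Ux) (dg x Ux).
Qed.

Lemma Ck_linear V E E' k (U : set V) (L : E -> E') (f : V -> E) : open U ->
  linear L -> continuous L -> Ck k U f -> Ck k U (L \o f).
Proof.
move=> oU linL cL; elim: k f => [|k IHk] f /=.
  by move=> cf x Ux; apply: continuous_comp; [exact: cf|exact: cL].
move=> [df Df]; split=> [x Ux|v].
  by have [] := is_diff_linear linL cL (df x Ux).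
apply: (Ck_ext oU _ (IHk _ (Df v))) => x Ux /=.
by have [_ ->] := is_diff_linear linL cL (df x Ux).
Qed.

Lemma Ck_sum V E k (U : set V) n (f : 'I_n -> V -> E) : open U ->
  (forall i, Ck k U (f i)) -> Ck k U (\sum_(i < n) f i).
Proof.
move=> oU Cf; elim/big_ind: _ => [|f1 f2|i _]; [exact: Ck_cst|exact: CkD|exact: Cf].
Qed.

End CkCalculus.

Section CkGraph.
Context (R : realType) (V E : normedModType R) (h : {dot V for idfun}).
Hypothesis fdV : finite_dimensional V.

Lemma Ck_dot (V' : normedModType R) k (U : set V') (f : V' -> V) y : open U ->
  Ck k U f -> Ck k U (fun x => h (f x) y : R).
Proof.
move=> oU; apply: (@Ck_linear _ _ _ _ _ _ (fun x => h x y : R)) => //.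
  by move=> a x z; rewrite dotDl dotZl.
exact: dot_continuous_l.
Qed.

(** Used to pass from smoothness of the connection in (point, vector) to smoothness of covariant
    derivatives along a field [A]. The chain rule produces the direction ['D_v A q], which varies
    with [q]; expanding it in an orthonormal basis leaves derivatives of [g] along constant vectors,
    to which induction applies. *)
Lemma Ck_comp_graph k (O : set (V * V)) (U : set V) (g : V * V -> E)
    (A : V -> V) : open U -> (forall q, U q -> O (q, A q)) ->
  Ck k O g -> Ck k U A -> Ck k U (fun q => g (q, A q)).
Proof.
move=> oU UO; elim: k g => [|k IHk] g Cg CA.
  move=> x Ux; apply: (@continuous_comp _ _ _ (fun q => (q, A q)) g).
    by apply: cvg_pair; [exact: cvg_id|exact: CA].
  by apply: Cg; exact: UO.
have [n [e [_ eb]]] := orthonormal_basis h fdV.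
have [dg Dg] := Cg; have [dA DA] := CA.
have dpair q : U q -> differentiable (fun q => (q, A q)) q.
  by move=> Uq; apply: differentiable_pair => //; exact: dA.
split=> [x Ux|v].
  apply: (@differentiable_comp _ _ _ _ (fun q => (q, A q)) g); first exact: dpair.
  by apply: dg; exact: UO.
have C1 := IHk _ (Dg (v, 0)) (CkW CA).
have C2 i : Ck k U (fun q => (h ('D_v A q) (e i) : R) *: 'D_(0, e i) g (q, A q)).
  by apply: (CkZ oU); [exact: (Ck_dot _ oU (DA v))|exact: (IHk _ (Dg (0, e i))
    (CkW CA))].
apply: (Ck_ext oU _ (CkD oU C1 (Ck_sum oU C2))) => q Uq /=.
have dgq := dg _ (UO _ Uq); have dpq := dpair _ Uq.
have := deriveE v (differentiable_comp dpq dgq);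
  rewrite (diff_comp dpq dgq) => /= ->.
rewrite (diff_pair (ex_diff) (dA q Uq)) /= diff_val -(deriveE _ (dA q Uq)).
rewrite -[LHS]/(_ + _) fct_sumE.
rewrite (_ : (v, 'D_v A q) = (v, 0) + \sum_(i < n) h ('D_v A q) (e i) *:
  (0, e i)); last first.
  transitivity ((v, 0) + (0, 'D_v A q) : V * V).
    by rewrite -[RHS]/(_, _) /= addr0 add0r.
  congr (_ + _); rewrite {1}(eb ('D_v A q)).
  elim/big_ind2: _ => [//|x1 y1 x2 y2 <- <-|i _].
    by rewrite -[RHS]/(_, _) /= addr0.
  by rewrite -[RHS]/(_, _) /= scaler0.
rewrite linearD/= -(deriveE _ dgq); congr (_ + _).
by rewrite linear_sum; apply: eq_bigr => i _; rewrite linearZ /= -(deriveE _ dgq).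
Qed.

End CkGraph.

(** * Symmetry of second derivatives *)

Section Schwarz.
Context (R : realType) (V : normedModType R).

(** Derivatives are taken at every parameter [s] of a line, not only at 0, which is the form the
    mean value theorem consumes. *)
Definition is_derive_along (U : set V) (u : V) (f f' : V -> R) :=
  forall x s, U (x + s *: u) ->
    is_derive s 1 (fun t : R => f (x + t *: u)) (f' (x + s *: u)).

(** Mean value theorem twice: for the increment [phi] along [u], then for [f1] along [w]. *)
Lemma second_difference (U : set V) (f f1 f2 : V -> R) (p u w : V) (d : R) :
  0 < d ->
  (forall s t : R, 0 <= s <= d -> 0 <= t <= d -> U (p + s *: u + t *: w)) ->
  is_derive_along U u f f1 -> is_derive_along U w f1 f2 ->
  exists s t : R, [/\ 0 <= s <= d, 0 <= t <= d &
    f (p + d *: u + d *: w) - f (p + d *: u) - (f (p + d *: w) - f p) =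
    f2 (p + s *: u + t *: w) * d ^+ 2].
Proof.
move=> d0 pU df df1.
have dd : 0 <= d <= d by rewrite (ltW d0) lexx.
have d00 : (0 : R) <= 0 <= d by rewrite (ltW d0) lexx.
pose phi (s : R) := f (p + d *: w + s *: u) - f (p + s *: u).
have Uw s : 0 <= s <= d -> U (p + d *: w + s *: u).
  by move=> sd; rewrite addrAC; exact: pU.
have U0 s : 0 <= s <= d -> U (p + s *: u).
  by move=> sd; rewrite -[_ + _]addr0 -(scale0r w); exact: pU.
have dphi s : 0 <= s <= d ->
    is_derive s 1 phi (f1 (p + d *: w + s *: u) - f1 (p + s *: u)).
  move=> sd; have D1 := df _ _ (Uw s sd).
  by have D2 := df _ _ (U0 s sd); exact: (is_deriveB D1 D2).
have cphi : {within `[0, d], continuous phi}.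
  by apply: derivable_within_continuous => s; rewrite in_itv/= => /dphi[].
have [s|s] := MVT d0 _ cphi (df := fun s => f1 (p + d *: w + s *: u) - f1
  (p + s *: u)).
  by rewrite in_itv/= => /andP[s0 sd]; apply: dphi; rewrite !ltW.
rewrite in_itv/= => /andP[/ltW s0 /ltW sd] phiE.
have sd' : 0 <= s <= d by rewrite s0.
have cpsi : {within `[0, d], continuous (fun t => f1 (p + s *: u + t *: w))}.
  apply: derivable_within_continuous => t; rewrite in_itv/= => td.
  by have [] := df1 _ _ (pU _ _ sd' td).
have [t|t] := MVT d0 _ cpsi (df := fun t => f2 (p + s *: u + t *: w)).
  rewrite in_itv/= => /andP[t0 td]; apply: df1.
  by apply: pU => //; rewrite !ltW.
rewrite in_itv/= => /andP[/ltW t0 /ltW td]; rewrite scale0r !addr0 !subr0 => psiE.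
exists s, t; split=> //; first by rewrite t0.
rewrite expr2 mulrA -psiE [p + s *: u + d *: w]addrAC subr0 in phiE *.
by rewrite -phiE /phi scale0r !addr0 [p + d *: u + _]addrAC.
Qed.

(** The second difference over a parallelogram is the same number in either order, so [fuw] and
    [fwu] agree at two points near [p]. If their values at [p] differed, continuity would keep each
    within half the gap of its value, which is impossible. *)
Lemma second_derivative_sym (U : set V) (f fu fw fuw fwu : V -> R) (p u w : V) :
  nbhs p U ->
  is_derive_along U u f fu -> is_derive_along U w fu fuw ->
  is_derive_along U w f fw -> is_derive_along U u fw fwu ->
  {for p, continuous fuw} -> {for p, continuous fwu} -> fuw p = fwu p.
Proof.
move=> Up dfu dfuw dfw dfwu cuw cwu; apply/eqP/negPn/negP => neq.
set a := fuw p in neq; set b := fwu p in neq.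
have e0 : 0 < `|a - b| / 2 by rewrite divr_gt0// normr_gt0 subr_eq0.
have na : \forall x \near p, `|a - fuw x| < `|a - b| / 2.
  by move/cvgrPdist_lt: cuw => /(_ _ e0).
have nb : \forall x \near p, `|b - fwu x| < `|a - b| / 2.
  by move/cvgrPdist_lt: cwu => /(_ _ e0).
have nearU : \forall x \near p, [/\ U x, `|a - fuw x| < `|a - b| / 2 &
    `|b - fwu x| < `|a - b| / 2].
  by apply: filterS3 Up na nb => x Ux ax bx; split.
have [r /= r0 rU] := (nbhs_ballP _ _).1 nearU.
(* This side length keeps the parallelogram inside the ball of radius [r]; the 1 covers
   [u = w = 0]. *)
pose d := r / (`|u| + `|w| + 1).
have n0 : 0 < `|u| + `|w| + 1 by rewrite ltr_wpDl// addr_ge0.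
have d0 : 0 < d by rewrite divr_gt0.
have ballp (x y : V) : `|x| + `|y| = `|u| + `|w| ->
    forall s t : R, 0 <= s <= d -> 0 <= t <= d -> ball p r (p + s *: x + t *: y).
  move=> xy s t /andP[s0 sd] /andP[t0 td].
  rewrite -ball_normE /ball_/= -addrA opprD addNKr normrN.
  rewrite (le_lt_trans (ler_normD _ _))// !normrZ !ger0_norm//.
  rewrite (@le_lt_trans _ _ (d * (`|x| + `|y|)))//.
    by rewrite mulrDr lerD// ler_wpM2r.
  by rewrite xy /d mulrAC ltr_pdivrMr// ltr_pM2l// ltrDl.
have Uuw s t (sd : 0 <= s <= d) (td : 0 <= t <= d) :=
  rU _ (ballp u w erefl s t sd td).
have Uwu s t (sd : 0 <= s <= d) (td : 0 <= t <= d) :=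
  rU _ (ballp w u (addrC _ _) s t sd td).
have [|s [t [sd td E1]]] := second_difference d0 _ dfu dfuw (p := p).
  by move=> s t sd td; have [] := Uuw s t sd td.
have [|s' [t' [sd' td' E2]]] := second_difference d0 _ dfw dfwu (p := p).
  by move=> s' t' sd' td'; have [] := Uwu s' t' sd' td'.
have [_ H1 _] := Uuw s t sd td.
have [_ _ H2] := Uwu s' t' sd' td'.
have eqD : fuw (p + s *: u + t *: w) = fwu (p + s' *: w + t' *: u).
  apply: (mulIf (expf_neq0 2 (lt0r_neq0 d0))).
  by rewrite -E1 -E2 [p + d *: w + _]addrAC; ring.
rewrite eqD in H1; set c := fwu _ in H1 H2.
have := ltrD H1 H2; rewrite -splitr => /(le_lt_trans (ler_normB _ _)).
by rewrite opprB addrA subrK ltxx.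
Qed.

End Schwarz.

Section SecondDerivative.
Context (R : realType) (V : normedModType R) (h : {dot V for idfun}).
Hypothesis fdV : finite_dimensional V.

Lemma dot_inj (x y : V) : (forall z, h x z = h y z) -> x = y.
Proof.
move=> xy; apply/eqP; rewrite -subr_eq0; apply/eqP/(dot_eq0 (h := h)).
by rewrite dotDl dotNl xy subrr.
Qed.

Lemma is_derive_scale (E : normedModType R) (a : R -> R) (g : R -> E)
  (t a' : R) (g' : E) :
  is_derive t 1 a a' -> is_derive t 1 g g' ->
  is_derive t 1 (fun s => a s *: g s) (a' *: g t + a t *: g').
Proof.
move=> [/derivable1_diffP da <-] [/derivable1_diffP dg <-].
have [dag Dag] := is_diff_scale da dg.
by split; [apply/derivable1_diffP|rewrite Dag].
Qed.

Lemma is_derive_along_dot (U : set V) (f : V -> V) (u z : V) :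
  (forall x, U x -> differentiable f x) ->
  is_derive_along U u (fun x => h (f x) z) (fun x => h ('D_u f x) z).
Proof.
move=> df x s Ux; have D1 := is_derive_line (df _ Ux).
apply: is_derive_eq; first exact: (is_derive_dot h fdV D1 (is_derive_cst z s 1)).
by rewrite dot0r addr0.
Qed.

Lemma derive_sym (U : set V) (f : V -> V) (p u w : V) : open U -> U p ->
  Ck 2 U f -> 'D_w (fun x => 'D_u f x) p = 'D_u (fun x => 'D_w f x) p.
Proof.
move=> oU Up [df Df]; apply: dot_inj => z.
have [du Du] := Df u; have [dw Dw] := Df w.
have c y : continuous (fun x : V => h x y : R) by exact: dot_continuous_l.
apply: (@second_derivative_sym _ _ U (fun x => h (f x) z)
  (fun x => h ('D_u f x) z) (fun x => h ('D_w f x) z)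
  (fun x => h ('D_w (fun x => 'D_u f x) x) z)
  (fun x => h ('D_u (fun x => 'D_w f x) x) z) p u w).
- exact: open_nbhs_nbhs.
- exact: is_derive_along_dot.
- exact: is_derive_along_dot.
- exact: is_derive_along_dot.
- exact: is_derive_along_dot.
- by apply: (@continuous_comp _ _ _ _ (fun x => h x z));
  [exact: (Du w p Up)|exact: c].
- by apply: (@continuous_comp _ _ _ _ (fun x => h x z));
  [exact: (Dw u p Up)|exact: c].
Qed.

Lemma derive_dot_basis (f : V -> V) n (e : 'I_n -> V) (x v : V) :
  (forall x, x = \sum_(i < n) h x (e i) *: e i) -> differentiable f x ->
  'D_v f x = \sum_(i < n) h v (e i) *: 'D_(e i) f x.
Proof.
move=> eb df; rewrite (deriveE _ df) {1}(eb v) linear_sum.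
by apply: eq_bigr => i _; rewrite linearZ /= -(deriveE _ df).
Qed.

(** Product rule for [D_Y Z] along a curve, with direction and base point both moving. The
    second-order term is stated with the direction frozen at [y 0]; it is symmetric in [c'] and
    [y 0], hence disappears from the curvature. *)
Lemma is_derive_derive_curve (U : set V) (Z : V -> V) (c y : R -> V) (p c' y' : V) :
  open U -> U p -> Ck 2 U Z -> c 0 = p ->
  is_derive (0 : R) 1 c c' -> is_derive (0 : R) 1 y y' ->
  is_derive (0 : R) 1 (fun t => 'D_(y t) Z (c t))
    ('D_y' Z p + 'D_c' (fun x => 'D_(y 0) Z x) p).
Proof.
move=> oU Up CZ c0 dc dy; have [dZ DZ] := CZ.
have [n [e [_ eb]]] := orthonormal_basis h fdV.
have cc : {for (0 : R), continuous c}.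
  by apply: differentiable_continuous; apply/derivable1_diffP; case: dc.
have Uc : \forall t \near (0 : R), U (c t).
  by apply: cc; rewrite c0; exact: open_nbhs_nbhs.
have dDi i : is_derive (0 : R) 1 (fun t => 'D_(e i) Z (c t))
    ('D_c' (fun x => 'D_(e i) Z x) p).
  rewrite -c0; apply: (@is_derive_comp_curve _ _ _ (fun x => 'D_(e i) Z x) c) => //.
  by have [dD _] := DZ (e i); apply: dD; rewrite c0.
have dyi i : is_derive (0 : R) 1 (fun t => h (y t) (e i)) (h y' (e i)).
  apply: is_derive_eq; first exact: (is_derive_dot h fdV dy (is_derive_cst
    (e i) _ _)).
  by rewrite dot0r addr0.
have D := is_derive_sum (fun i => is_derive_scale (dyi i) (dDi i)).
apply: (near_eq_is_derive _ (is_derive_eq D _)).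
  apply: filterS Uc => t Uct; rewrite fct_sumE.
  by rewrite (derive_dot_basis _ eb (dZ _ Uct)).
rewrite big_split /= c0; congr (_ + _).
  by rewrite (derive_dot_basis _ eb (dZ _ Up)).
(* After the swap [y 0] is the outer direction, in which the derivative is linear and can be
   expanded in the basis; swapping back matches the sum term by term. *)
rewrite (derive_sym _ _ oU Up CZ).
have dDc : differentiable (fun x => 'D_c' Z x) p by have [dD _] := DZ c'; exact: dD.
rewrite (derive_dot_basis _ eb dDc); apply: eq_bigr => i _.
by rewrite (derive_sym _ _ oU Up CZ).
Qed.

End SecondDerivative.

(** * Smoothness along a submanifold *)

Section Smooth.
Context (R : realType).

Lemma smooth_at_near (V E : normedModType R) (f : V -> E) (p : V) :
  smooth_at f p -> \forall q \near p, smooth_at f q.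
Proof.
move=> [U [oU Up Cf]]; apply: filterS (open_nbhs_nbhs (conj oU Up)) => q Uq.
by exists U.
Qed.

Lemma smooth_along_near (V E : normedModType R) (S : set V) (f : V -> E) (p : V) :
  smooth_along S f p -> \forall q \near p, smooth_along S f q.
Proof.
move=> [g [/smooth_at_near sg /near_join fg]].
by apply: filterS2 sg fg => q sgq fgq; exists g.
Qed.

Lemma smooth_along_ext (V E : normedModType R) (S : set V) (f f' : V -> E) (p : V) :
  (\forall q \near p, S q -> f q = f' q) -> smooth_along S f p ->
  smooth_along S f' p.
Proof.
move=> ff' [g [sg fg]]; exists g; split=> //.
by apply: filterS2 ff' fg => q + + Sq => <-// ->.
Qed.

Lemma smooth_alongB (V E : normedModType R) (S : set V) (f f' : V -> E) (p : V) :
  smooth_along S f p -> smooth_along S f' p -> smooth_along S (f - f') p.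
Proof.
move=> [g [[U [oU Up Cg]] fg]] [g' [[U' [oU' Up' Cg']] fg']].
exists (g - g'); split; last first.
  apply: filterS2 fg fg' => q fgq fgq' Sq.
  by rewrite -[LHS]/(f q - f' q) fgq ?fgq'.
have oUU := openI oU oU'.
exists (U `&` U'); split=> // k; apply: CkD => //.
  by apply: Ck_subset (Cg k) => x [].
by apply: CkN => //; apply: Ck_subset (Cg' k) => x [].
Qed.

Lemma smooth_alongP (V E : normedModType R) (S : set V) (f : V -> E) (p : V) :
  smooth_along S f p -> exists g U, [/\ open U, U p, forall k, Ck k U g &
    forall q, U q -> S q -> f q = g q].
Proof.
move=> [g [[U [oU Up Cg]] fg]].
have : nbhs p [set q | S q -> f q = g q] by exact: fg.
rewrite nbhsE; case=> U' [oU' Up'] Ufg.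
exists g, (U `&` U'); split=> [|//|k|q [_ Uq]]; first exact: openI.
  by apply: Ck_subset (Cg k) => x [].
exact: Ufg.
Qed.

Context (V : normedModType R) (S : set V).

Lemma curve_is_derive p v c : curve_through S p v c -> is_derive (0 : R) 1 c v.
Proof.
move=> [[U [oU U0 Cc]] _ _ <-]; have [dc _] := Cc 1%N.
by rewrite derive1E; apply: DeriveDef => //; apply: diff_derivable; exact: dc.
Qed.

Lemma curve_near p v c (P : set V) : curve_through S p v c ->
  (\forall q \near p, S q -> P q) -> \forall t \near (0 : R), P (c t).
Proof.
move=> cpv SP; have dc := curve_is_derive cpv; have [_ Sc c0 _] := cpv.
have cc : {for (0 : R), continuous c}.
  by apply: differentiable_continuous; apply/derivable1_diffP; case: dc.
have : \forall t \near (0 : R), S (c t) -> P (c t).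
  by apply: (cc [set q | S q -> P q]); rewrite c0.
by apply: filterS2 Sc => t Sct; apply.
Qed.

Lemma tderive_is_derive (E : normedModType R) (f : V -> E) (p v : V) :
  tangent S p v -> smooth_along S f p ->
  let c := get (curve_through S p v) in
  curve_through S p v c /\ is_derive (0 : R) 1 (f \o c) (tderive S f p v).
Proof.
move=> /getPex cpv /smooth_alongP[g [U [oU Up Cg fg]]] c; split=> //.
have dg : differentiable g p by have [dg _] := Cg 1%N; exact: dg.
have [_ _ c0 _] := cpv; have dc := curve_is_derive cpv; rewrite -/c in c0 dc.
have : is_derive (0 : R) 1 (f \o c) ('D_v g p).
  have D : is_derive (0 : R) 1 (g \o c) ('D_v g p).
    by rewrite -c0; apply: is_derive_comp_curve; rewrite ?c0.
  apply: near_eq_is_derive D; apply: (curve_near cpv (P := fun q => g q = f q)).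
  by apply: filterS (open_nbhs_nbhs (conj oU Up)) => q Uq Sq; rewrite fg.
by move=> [D1 D2]; rewrite /tderive -/c derive1E; exact: DeriveDef.
Qed.

(** The curve chosen by [get] is immaterial: the chain rule for any ambient extension [g] gives the
    same value. *)
Lemma tderive_eq (E : normedModType R) (f g : V -> E) (p v : V) :
  tangent S p v -> (\forall q \near p, S q -> f q = g q) ->
  differentiable g p -> tderive S f p v = 'D_v g p.
Proof.
move=> /getPex cpv fg dg; rewrite /tderive; set c := get _ in cpv *.
have [_ _ c0 _] := cpv; have dc := curve_is_derive cpv.
have D : is_derive (0 : R) 1 (g \o c) ('D_v g p).
  by rewrite -c0; apply: is_derive_comp_curve; rewrite ?c0.
have D2 : is_derive (0 : R) 1 (f \o c) ('D_v g p).
  apply: near_eq_is_derive D; apply: (curve_near cpv (P := fun q => g q = f q)).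
  by apply: filterS fg => q fgq Sq; rewrite fgq.
by rewrite derive1E; have [] := D2.
Qed.

End Smooth.

(** * Differentiation rules for real functions *)

Section RealCurves.
Context (R : realType).
Implicit Types (f g : R -> R) (t df dg : R).

Lemma is_derive_mul f g t df dg : is_derive t 1 f df -> is_derive t 1 g dg ->
  is_derive t 1 (fun s => f s * g s) (df * g t + f t * dg).
Proof.
move=> Df Dg; have D := is_deriveM Df Dg; apply: (is_derive_eq D).
by rewrite addrC /GRing.scale/= [g t * _]mulrC.
Qed.

Lemma is_derive_add f g t df dg : is_derive t 1 f df -> is_derive t 1 g dg ->
  is_derive t 1 (fun s => f s + g s) (df + dg).
Proof. by move=> Df Dg; exact: (is_deriveD Df Dg). Qed.

Lemma is_derive_sub f g t df dg : is_derive t 1 f df -> is_derive t 1 g dg ->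
  is_derive t 1 (fun s => f s - g s) (df - dg).
Proof. by move=> Df Dg; exact: (is_deriveB Df Dg). Qed.

Lemma is_derive_cmul (a : R) f t df : is_derive t 1 f df ->
  is_derive t 1 (fun s => a * f s) (a * df).
Proof. by move=> Df; exact: (is_deriveZ a Df). Qed.

Lemma is_derive_inv f t df : f t != 0 -> is_derive t 1 f df ->
  is_derive t 1 (fun s => (f s)^-1) (- df / f t ^+ 2).
Proof.
move=> ft Df; have D := is_deriveV ft Df; apply: (is_derive_eq D).
by rewrite /GRing.scale/= mulrC mulNr mulrN.
Qed.

Lemma is_derive_div f g t df dg : g t != 0 ->
  is_derive t 1 f df -> is_derive t 1 g dg ->
  is_derive t 1 (fun s => f s / g s) ((df * g t - f t * dg) / g t ^+ 2).
Proof.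
move=> gt Df Dg; have D0 := is_derive_mul Df (is_derive_inv gt Dg);
  apply: (is_derive_eq D0).
by field.
Qed.

Lemma curve_neq0 (V : normedModType R) (c : R -> V) (c' : V) (t : R) :
  is_derive t 1 c c' -> c t != 0 -> \forall s \near t, c s != 0.
Proof.
move=> [/derivable1_diffP/differentiable_continuous cc _] ct.
have n0 : 0 < `|c t| by rewrite normr_gt0.
move/cvgrPdist_lt: cc => /(_ _ n0); apply: filterS => s.
by apply: contraTN => /eqP ->; rewrite subr0 ltxx.
Qed.

End RealCurves.

(** * Randers norms and their fundamental and Cartan tensors *)

Section RandersMinkowski.
Context (R : realType) (V : normedModType R) (h : {dot V for idfun}) (W : V).
Context (F : V -> R).
Hypothesis fdV : finite_dimensional V.
Hypothesis hW : h W W < 1.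
Hypothesis hF : zermelo_norm h W F.

Definition lam := 1 - h W W.

(* [rad v = sqrt (h v W ^+ 2 + lam * h v v)], by the quadratic equation of [F] *)
Definition rad v := lam * F v + h v W.

(** The differential of [F] at [v], obtained by differentiating the quadratic equation of [F]
    implicitly. *)
Definition Fdiff v u := (h v u - F v * h W u) / rad v.

(* [F v * rad v^-1 * angular v] is [F] times the Hessian of [F] *)
Definition angular v u w :=
  h u w - Fdiff v u * h W w - Fdiff v w * h W u - lam * Fdiff v u * Fdiff v w.

Definition drad v u := h W u + lam * Fdiff v u.

(** Half the Hessian of the square of [F], split as [dF dF + F Hess F]. *)
Definition randers_g v u w := Fdiff v u * Fdiff v w + F v / rad v * angular v u w.

(* [drad_tilde v w = h W (tilde h W F v w)] *)
Definition drad_tilde v w := drad v w - Fdiff v w * rad v / F v.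

(** The Cartan tensor, in the C-reducible shape typical of Randers norms: the symmetrized product of
    the angular form with one covector. *)
Definition randers_C v u w z := - (F v / (2 * rad v ^+ 2)) *
  (angular v u w * drad_tilde v z + angular v w z * drad_tilde v u
   + angular v u z * drad_tilde v w).

Lemma lam_gt0 : 0 < lam. Proof. by rewrite subr_gt0. Qed.

Lemma F_gt0 v : v != 0 -> 0 < F v. Proof. by case: hF => _ H /H[]. Qed.

Lemma F_quadratic v : lam * F v ^+ 2 + 2 * F v * h v W = h v v.
Proof.
have [F0 HF] := hF; have [->|v0] := eqVneq v 0.
  by rewrite F0 !dot0l expr0n/= !mulr0 ?mul0r ?addr0.
have [Fv] := HF v v0; rewrite !dotE => /(congr1 ( *%R^~ (F v ^+ 2))).
rewrite [h W v]dotC /lam => E; have Fn : F v != 0 by rewrite gt_eqF.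
have -> : h v v = ((F v)^-1 * ((F v)^-1 * h v v)) * F v ^+ 2 by field.
move: E; rewrite !mulrBl !mulrDl => E.
have E2 : ((F v)^-1 * h v W) * F v ^+ 2 = F v * h v W by field.
lra.
Qed.

Lemma rad_gt0 v : v != 0 -> 0 < rad v.
Proof.
move=> v0; have Fv := F_gt0 v0; have q := F_quadratic v.
have q0 := dot_gt0 h v0; have l0 := lam_gt0.
have : 0 < 2 * F v * rad v.
  have -> : 2 * F v * rad v = lam * F v ^+ 2 + h v v by rewrite -q /rad; ring.
  by rewrite addr_gt0// mulr_gt0// exprn_gt0.
by rewrite pmulr_rgt0// mulr_gt0.
Qed.

(** Solving the quadratic equation exhibits [rad], hence [F], as differentiable away from 0 without
    an implicit function theorem. *)
Lemma radE v : rad v = Num.sqrt (h v W ^+ 2 + lam * h v v).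
Proof.
have -> : h v W ^+ 2 + lam * h v v = rad v ^+ 2 by rewrite -F_quadratic /rad; ring.
have [->|/rad_gt0 v0] := eqVneq v 0; last by rewrite sqrtr_sqr gtr0_norm.
by rewrite /rad dot0l (proj1 hF) mulr0 addr0 expr0n sqrtr0.
Qed.

Lemma is_derive_dotr (a : R -> V) (t : R) (a' y : V) : is_derive t 1 a a' ->
  is_derive t 1 (fun s => h (a s) y) (h a' y).
Proof.
move=> Da; have D0 := is_derive_dot h fdV Da (is_derive_cst y _ _);
  apply: (is_derive_eq D0).
by rewrite dot0r addr0.
Qed.

Lemma is_derive_rad (a : R -> V) (t : R) (a' : V) : a t != 0 ->
  is_derive t 1 a a' -> is_derive t 1 (fun s => rad (a s)) (drad (a t) a').
Proof.
move=> a0 Da; have r0 := rad_gt0 a0.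
pose q s := h (a s) W ^+ 2 + lam * h (a s) (a s).
rewrite (_ : (fun s => _) = Num.sqrt \o q); last first.
  by apply/funext => s; rewrite radE.
have p0 : 0 < q t by rewrite -sqrtr_gt0 -radE.
have D1 := is_derive_dotr W Da.
have D2 : is_derive t 1 q _ :=
  is_derive_add (is_derive_mul D1 D1) (is_derive_cmul lam
    (is_derive_dot h fdV Da Da)).
have D0 := is_derive1_comp (is_derive1_sqrt p0) D2; apply: (is_derive_eq D0).
have rn : rad (a t) != 0 by rewrite gt_eqF.
have Em : h (a t) W = rad (a t) - lam * F (a t) by rewrite /rad addrAC subrr add0r.
have -> : Num.sqrt (q t) = rad (a t) by rewrite radE.
rewrite /= /drad /Fdiff [h a' (a t)]dotC [h a' W]dotC Em.
by field.
Qed.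

Lemma is_derive_F (a : R -> V) (t : R) (a' : V) : a t != 0 ->
  is_derive t 1 a a' -> is_derive t 1 (fun s => F (a s)) (Fdiff (a t) a').
Proof.
move=> a0 Da; have l0 : lam != 0 by rewrite gt_eqF// lam_gt0.
rewrite (_ : (fun s => _) = (fun s => lam^-1 * (rad (a s) - h (a s) W)));
  last first.
  by apply/funext => s; rewrite /rad; field.
have D0 := is_derive_cmul lam^-1 (is_derive_sub (is_derive_rad a0 Da)
  (is_derive_dotr W Da)).
apply: (is_derive_eq D0).
by rewrite [h a' W]dotC /drad addrAC subrr add0r mulKf.
Qed.

Lemma is_derive_Fdiff (a y : R -> V) (t : R) (a' y' : V) : a t != 0 ->
  is_derive t 1 a a' -> is_derive t 1 y y' ->
  is_derive t 1 (fun s => Fdiff (a s) (y s))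
    (angular (a t) a' (y t) / rad (a t) + Fdiff (a t) y').
Proof.
move=> a0 Da Dy; have rn : rad (a t) != 0 by rewrite gt_eqF// rad_gt0.
have DW : is_derive t 1 (fun s => h W (y s)) (h W y').
  have := is_derive_dotr W Dy; rewrite [h y' W]dotC => D.
  by rewrite (_ : (fun s => _) = (fun s => h (y s) W))//; apply/funext => s;
    rewrite dotC.
have D := is_derive_sub (is_derive_dot h fdV Da Dy) (is_derive_mul
  (is_derive_F a0 Da) DW).
have D0 := is_derive_div (g := fun s => rad (a s)) rn D (is_derive_rad a0 Da);
  apply: (is_derive_eq D0).
have E y0 : h (a t) y0 = Fdiff (a t) y0 * rad (a t) + F (a t) * h W y0.
  by rewrite /Fdiff divfK// subrK.
by rewrite !E /angular /drad; field.
Qed.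

Lemma is_derive_angular (a y z : R -> V) (t : R) (a' y' z' : V) : a t != 0 ->
  is_derive t 1 a a' -> is_derive t 1 y y' -> is_derive t 1 z z' ->
  is_derive t 1 (fun s => angular (a s) (y s) (z s))
    (- (angular (a t) a' (y t) * drad (a t) (z t)
        + angular (a t) a' (z t) * drad (a t) (y t)) / rad (a t)
     + angular (a t) y' (z t) + angular (a t) (y t) z').
Proof.
move=> a0 Da Dy Dz; have rn : rad (a t) != 0 by rewrite gt_eqF// rad_gt0.
have DW b b' : is_derive t 1 b b' -> is_derive t 1 (fun s => h W (b s)) (h W b').
  move=> Db; have := is_derive_dotr W Db; rewrite [h b' W]dotC => D.
  by rewrite (_ : (fun s => _) = (fun s => h (b s) W))//; apply/funext => s;
    rewrite dotC.
have Ny := is_derive_Fdiff a0 Da Dy; have Nz := is_derive_Fdiff a0 Da Dz.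
have D0 := is_derive_sub (is_derive_sub (is_derive_sub (is_derive_dot h fdV Dy Dz)
    (is_derive_mul Ny (DW _ _ Dz))) (is_derive_mul Nz (DW _ _ Dy)))
    (is_derive_mul (is_derive_cmul lam Ny) Nz).
apply: (is_derive_eq D0).
set Ay := angular _ a' (y t); set Az := angular _ a' (z t).
by rewrite /angular /drad; field.
Qed.

Local Notation g := randers_g.
Local Notation C := randers_C.
Local Notation S := (indicatrix F).
Local Notation N := (Nvec W).
Implicit Types u v w z : V.

(** * Linearity, symmetry and degeneracy of these tensors *)

Lemma FdiffD v u w : Fdiff v (u + w) = Fdiff v u + Fdiff v w.
Proof. by rewrite /Fdiff !dotDr; ring. Qed.

Lemma FdiffZ v a u : Fdiff v (a *: u) = a * Fdiff v u.
Proof. by rewrite /Fdiff !dotZr; ring. Qed.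

Lemma angularC v u w : angular v u w = angular v w u.
Proof. by rewrite /angular [h w u]dotC; ring. Qed.

Lemma angularDl v u w z : angular v (u + w) z = angular v u z + angular v w z.
Proof. by rewrite /angular FdiffD dotDl !dotDr; ring. Qed.

Lemma angularZl v a u z : angular v (a *: u) z = a * angular v u z.
Proof. by rewrite /angular FdiffZ dotZl !dotZr; ring. Qed.

Lemma randers_gC v u w : g v u w = g v w u.
Proof. by rewrite /randers_g angularC [Fdiff v u * _]mulrC. Qed.

Lemma randers_gDl v u w z : g v (u + w) z = g v u z + g v w z.
Proof. by rewrite /randers_g angularDl FdiffD; ring. Qed.

Lemma randers_gZl v a u z : g v (a *: u) z = a * g v u z.
Proof. by rewrite /randers_g angularZl FdiffZ; ring. Qed.

Lemma randers_gDr v u w z : g v z (u + w) = g v z u + g v z w.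
Proof. by rewrite !(randers_gC v z) randers_gDl. Qed.

Lemma randers_gZr v a u z : g v z (a *: u) = a * g v z u.
Proof. by rewrite !(randers_gC v z) randers_gZl. Qed.

Lemma randers_gBl v u w z : g v (u - w) z = g v u z - g v w z.
Proof. by rewrite randers_gDl -scaleN1r randers_gZl mulN1r. Qed.

Lemma randers_gBr v u w z : g v z (u - w) = g v z u - g v z w.
Proof. by rewrite !(randers_gC v z) randers_gBl. Qed.

Lemma dradD v u w : drad v (u + w) = drad v u + drad v w.
Proof. by rewrite /drad FdiffD dotDr; ring. Qed.

Lemma dradZ v a u : drad v (a *: u) = a * drad v u.
Proof. by rewrite /drad FdiffZ dotZr; ring. Qed.

Lemma randers_C12 v u w z : C v u w z = C v w u z.
Proof. by rewrite /randers_C [angular v w u]angularC; ring. Qed.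

Lemma randers_C23 v u w z : C v u w z = C v u z w.
Proof. by rewrite /randers_C [angular v z w]angularC; ring. Qed.

Lemma randers_CZl v a u w z : C v (a *: u) w z = a * C v u w z.
Proof. by rewrite /randers_C /drad_tilde !angularZl FdiffZ dradZ; ring. Qed.

Section At.
Context (v : V).
Hypothesis v0 : v != 0.

Let r0 : rad v != 0. Proof. by rewrite gt_eqF// rad_gt0. Qed.
Let F0 : F v != 0. Proof. by rewrite gt_eqF// F_gt0. Qed.
Let dotWv : h v W = rad v - lam * F v.
Proof. by rewrite /rad addrAC subrr add0r. Qed.
Let dotvv : h v v = F v * (2 * rad v - lam * F v).
Proof. by rewrite -F_quadratic dotWv; ring. Qed.
Let dotv u : h v u = Fdiff v u * rad v + F v * h W u.
Proof. by rewrite /Fdiff divfK// subrK. Qed.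

Lemma Fdiff_self : Fdiff v v = F v.
Proof. by rewrite /Fdiff [h W v]dotC dotvv dotWv; field. Qed.

Lemma drad_self : drad v v = rad v.
Proof. by rewrite /drad Fdiff_self [h W v]dotC dotWv; ring. Qed.

Lemma drad_tilde_self : drad_tilde v v = 0.
Proof. by rewrite /drad_tilde drad_self Fdiff_self; field. Qed.

Lemma angular_self w : angular v v w = 0.
Proof. by rewrite /angular Fdiff_self dotv [h W v]dotC dotWv; ring. Qed.

Lemma randers_g_self w : g v v w = F v * Fdiff v w.
Proof. by rewrite /randers_g Fdiff_self angular_self mulr0 addr0. Qed.

Lemma randers_C_self u w : C v v u w = 0.
Proof. by rewrite /randers_C !angular_self drad_tilde_self; ring. Qed.

Lemma randers_C_self2 u w : C v u v w = 0. Proof. by rewrite randers_C12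
  randers_C_self. Qed.
Lemma randers_C_self3 u w : C v u w v = 0. Proof. by rewrite randers_C23
  randers_C_self2. Qed.

(** Since [phi] equals [rad v / F v], [tilde] is the projection along [v] onto the kernel of
    [Fdiff v], which is the [g v]-complement of [v]. *)
Lemma tildeE u : tilde h W F v u = u - (Fdiff v u / F v) *: v.
Proof.
rewrite /tilde scalerA; congr (_ - _ *: _).
have -> : phi h W F v = rad v / F v.
  by rewrite /phi !dotE [h W v]dotC dotvv dotWv; field.
by rewrite dotDl dotNl dotZl /Fdiff; field; rewrite F0.
Qed.

Lemma angularE u w : angular v u w = h (tilde h W F v u) (tilde h W F v w).
Proof.
rewrite !tildeE !(dotDl, dotDr, dotNl, dotNr, dotZl, dotZr) [h u v]dotC !dotv.
by rewrite [h W v]dotC dotWv Fdiff_self /angular; field.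
Qed.

(** By [angularE], [g v w w] is a sum of two nonnegative terms. The first controls the component of
    [w] along [v], the second its projection [tilde]. *)
Lemma randers_g_eq0 w : g v w w = 0 -> w = 0.
Proof.
rewrite /randers_g angularE; set t := tilde _ _ _ _ _ => gw.
have a0 := dot_ge0 h t; have d0 := sqr_ge0 (Fdiff v w).
have c0 : 0 < F v / rad v by rewrite divr_gt0 ?rad_gt0 ?F_gt0.
have : Fdiff v w = 0 /\ t = 0.
  have ct0 : 0 <= F v / rad v * h t t by rewrite mulr_ge0// ltW.
  have d1 : Fdiff v w ^+ 2 = 0 by rewrite expr2 in d0 *; lra.
  have t1 : F v / rad v * h t t = 0 by rewrite expr2 in d1; lra.
  split; first by apply/eqP; rewrite -sqrf_eq0 d1.
  by apply: (dot_eq0 (h := h)); apply/eqP; move/eqP: t1;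
    rewrite mulf_eq0 (gt_eqF c0).
by rewrite /t tildeE => -[->]; rewrite mul0r scale0r subr0.
Qed.

End At.

(** Almost metricity of the flat derivative, for arbitrary ambient vectors along a curve. *)
Lemma is_derive_randers_g (a y z : R -> V) (t : R) (a' y' z' : V) : a t != 0 ->
  is_derive t 1 a a' -> is_derive t 1 y y' -> is_derive t 1 z z' ->
  is_derive t 1 (fun s => g (a s) (y s) (z s))
    (2 * C (a t) a' (y t) (z t) + g (a t) y' (z t) + g (a t) (y t) z').
Proof.
move=> a0 Da Dy Dz; have rn : rad (a t) != 0 by rewrite gt_eqF// rad_gt0.
have Fn : F (a t) != 0 by rewrite gt_eqF// F_gt0.
have Ny := is_derive_Fdiff a0 Da Dy.
have Nz := is_derive_Fdiff a0 Da Dz.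
have DF := is_derive_F a0 Da.
have Dr := is_derive_rad a0 Da.
have D0 := is_derive_add (is_derive_mul Ny Nz)
  (is_derive_mul (is_derive_div (g := fun s => rad (a s)) rn DF Dr)
     (is_derive_angular a0 Da Dy Dz)).
apply: (is_derive_eq D0).
rewrite /randers_C /randers_g /drad_tilde [angular _ (y t) z']angularC.
by field; rewrite rn.
Qed.

Lemma is_derive_shift_line v u : is_derive (0 : R) 1 (fun t : R => v + t *: u) u.
Proof.
have -> : (fun s : R => v + s *: u) = cst v + ( *:%R ^~ u) by [].
apply: is_derive_eq; last exact: add0r.
apply: is_deriveD; split; first exact/diff_derivable.
by rewrite deriveE// diff_val scale1r.
Qed.

Lemma near_line v u : v != 0 -> \forall t \near (0 : R), v + t *: u != 0.
Proof.
move=> v0; apply: (curve_neq0 (is_derive_shift_line v u)).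
by rewrite scale0r addr0.
Qed.

Lemma fund_tensorE v u w : v != 0 -> fund_tensor (fun v =>
  F v ^+ 2) v u w = g v u w.
Proof.
move=> v0; rewrite /fund_tensor.
pose G s := 2 * (F (v + s *: u) * Fdiff (v + s *: u) w).
have D1 : is_derive (0 : R) 1 G (2 * g v u w).
  have Dv := is_derive_shift_line v u.
  have v00 : v + (0 : R) *: u != 0 by rewrite scale0r addr0.
  have D0 := is_derive_cmul 2 (is_derive_mul (is_derive_F v00 Dv)
    (is_derive_Fdiff v00 Dv (is_derive_cst w _ _))).
  apply: (is_derive_eq D0); rewrite scale0r addr0 /randers_g.
  rewrite /cst -(scale0r 0) FdiffZ.
  by ring.
rewrite derive1E; suff -> : 'D_1 (fun s : R => derive1 (fun t : R =>
  F (v + s *: u + t *: w) ^+ 2) 0) 0 = 2 * g v u w.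
  by rewrite mulKf.
have -> : 2 * g v u w = 'D_1 G 0 by rewrite derive_val.
apply: near_eq_derive; apply: filterS (near_line u v0) => s vs0.
have Dw := is_derive_shift_line (v + s *: u) w.
have vs00 : v + s *: u + (0 : R) *: w != 0 by rewrite scale0r addr0.
have D2 := is_derive_F vs00 Dw.
have D3 := is_derive_mul D2 D2.
rewrite derive1E; have [_ D4] := D3; rewrite -[LHS]/('D_1 (fun t : R =>
  F (v + s *: u + t *: w) * F (v + s *: u + t *: w)) 0).
by rewrite D4 scale0r addr0 /G; ring.
Qed.

Lemma cartan_tensorE v u w z : v != 0 ->
  cartan_tensor (fun v => F v ^+ 2) v u w z = C v u w z.
Proof.
move=> v0; rewrite /cartan_tensor derive1E.
have v00 : v + (0 : R) *: z != 0 by rewrite scale0r addr0.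
have D0 := is_derive_randers_g v00 (is_derive_shift_line v z)
  (is_derive_cst u _ _) (is_derive_cst w _ _).
have -> : 'D_1 (fun t : R => fund_tensor (fun v => F v ^+ 2) (v + t *: z) u w) 0 =
   'D_1 (fun t : R => g (v + t *: z) u w) 0.
  by apply: near_eq_derive; apply: filterS (near_line z v0) => t vt;
    rewrite fund_tensorE.
have [_ D1] := D0; rewrite /cst in D1.
rewrite D1 scale0r addr0 -(scale0r 0) randers_gZl randers_gZr !mul0r !addr0 mulKf//.
by rewrite randers_C12 randers_C23.
Qed.

(** * The indicatrix *)

(** By the quadratic equation, the sphere equation factors as [(F x - 1) * (lam * F x + lam + 2 * h
    x W) = 0]. The second factor times [F x] is [h x x + lam * F x], which is positive for nonzero
    [x]; and 0 is not on the sphere because [h W W < 1]. *)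
Lemma indicatrixP x : S x <-> h (N x) (N x) = 1.
Proof.
have -> : h (N x) (N x) = h x x - 2 * h x W + h W W.
  by rewrite /Nvec !dotE [h W x]dotC; ring.
rewrite -F_quadratic /indicatrix/= /lam; split=> [->|E].
  by ring.
have l0 := lam_gt0; rewrite /lam in l0.
have [x0|x0] := eqVneq x 0.
  move: E; rewrite x0 (proj1 hF) dot0l => E.
  by exfalso; move: hW; rewrite -E; lra.
have r0 := rad_gt0 x0; have Fx := F_gt0 x0.
have q0 := dot_gt0 h x0; rewrite -F_quadratic /lam in q0.
have : (F x - 1) * (F x * (1 - h W W) + (1 - h W W) + 2 * h x W) = 0 by lra.
move/eqP; rewrite mulf_eq0 subr_eq0 => /orP[/eqP//|/eqP E2].
exfalso; have : 0 < (1 - h W W) * F x ^+ 2 + 2 * F x * h x W + F x * (1 - h W W).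
  by rewrite addr_gt0// mulr_gt0.
have -> : (1 - h W W) * F x ^+ 2 + 2 * F x * h x W + F x * (1 - h W W) =
  F x * (F x * (1 - h W W) + (1 - h W W) + 2 * h x W) by ring.
by rewrite E2 mulr0 ltxx.
Qed.

Definition height x := h (N x) W.

(* the [g v]-normal of the indicatrix at [x], normalized by [h (N x) _ = 1] *)
Definition g_normal x v :=
  (1 - height x ^+ 2)^-1 *: (N x + height x *: ((F v)^-1 *: v - W)).

(** Comes from the Cartan term of almost metricity: on tangent vectors [u], [w],
    [C v (- h v v *: nu) u w] equals this coefficient times [g v (tilde u) w]. *)
Definition normal_coeff x v := h v v * height x / (2 * F v * (1 - height x ^+ 2)).

(* [g v v (nabla p v Y Z - D_Y Z)], as shown in [g_nabla] *)
Definition chern_form x v y z := F v / rad v * normal_coeff x v * angular v y z.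

Section At.
Context (x v : V).
Hypotheses (Sx : S x) (v0 : v != 0).
Local Notation f := (height x).
Local Notation nu := (g_normal x v).

Lemma height_lt1 : 0 < 1 - f ^+ 2.
Proof.
rewrite subr_gt0; apply: le_lt_trans (CauchySchwarz_dot h _ _) _.
by rewrite ((indicatrixP x).1 Sx) mul1r.
Qed.

Let f0 : 1 - f ^+ 2 != 0. Proof. by rewrite gt_eqF// height_lt1. Qed.
Let r0 : rad v != 0. Proof. by rewrite gt_eqF// rad_gt0. Qed.
Let F0 : F v != 0. Proof. by rewrite gt_eqF// F_gt0. Qed.
Let dotWv : h v W = rad v - lam * F v.
Proof. by rewrite /rad addrAC subrr add0r. Qed.
Let dotvv : h v v = F v * (2 * rad v - lam * F v).
Proof. by rewrite -F_quadratic dotWv; ring. Qed.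
Let dotv u : h v u = Fdiff v u * rad v + F v * h W u.
Proof. by rewrite /Fdiff divfK// subrK. Qed.

Let dotWW : h W W = 1 - lam. Proof. by rewrite /lam opprB addrC subrK. Qed.

Hypothesis Tv : h (N x) v = 0.

Let dot_nuE w : h nu w =
  (1 - f ^+ 2)^-1 * (h (N x) w + f * ((F v)^-1 * h v w - h W w)).
Proof. by rewrite dotZl dotDl dotZl dotDl dotZl [h (- W) w]dotNl. Qed.

Lemma dot_nu w : h nu w = (h (N x) w + f * (Fdiff v w * rad v / F v)) /
  (1 - f ^+ 2).
Proof. by rewrite dot_nuE dotv; field; rewrite ?F0 ?r0 ?f0. Qed.

Lemma dot_nu_W : h W nu = f * rad v / (F v * (1 - f ^+ 2)).
Proof.
by rewrite dotC dot_nuE dotWv dotWW -/(height x); field; rewrite ?F0 ?r0 ?f0.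
Qed.

Lemma dot_N_nu : h (N x) nu = 1.
Proof.
rewrite dotC dot_nuE ((indicatrixP x).1 Sx) dotC Tv [h W _]dotC -/(height x).
by field; rewrite ?F0 ?r0 ?f0.
Qed.

Lemma dot_v_nu : h v nu = f * rad v / (1 - f ^+ 2).
Proof. by rewrite dotC dot_nu Tv (Fdiff_self v0); field; rewrite ?F0 ?r0 ?f0. Qed.

Lemma Fdiff_nu : Fdiff v nu = 0.
Proof. by rewrite /Fdiff dot_v_nu dot_nu_W; field; rewrite ?F0 ?r0 ?f0. Qed.

Lemma angular_nu w : angular v nu w = h (N x) w / (1 - f ^+ 2).
Proof. by rewrite /angular Fdiff_nu dot_nu dot_nu_W; field;
  rewrite ?F0 ?r0 ?f0. Qed.

Lemma drad_nu : drad v nu = f * rad v / (F v * (1 - f ^+ 2)).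
Proof. by rewrite /drad Fdiff_nu mulr0 addr0 dot_nu_W. Qed.

Lemma g_nu w : g v nu w = F v / (rad v * (1 - f ^+ 2)) * h (N x) w.
Proof. by rewrite /randers_g Fdiff_nu angular_nu; field; rewrite ?F0 ?r0 ?f0. Qed.

(** As [angular v nu] is a multiple of [h (N x)], two of the three terms of the Cartan tensor vanish
    on tangent vectors. *)
Lemma C_nu u w : h (N x) u = 0 -> h (N x) w = 0 ->
  C v (- h v v *: nu) u w = chern_form x v u w.
Proof.
move=> Tu Tw; rewrite randers_CZl /randers_C !angular_nu Tu Tw /drad_tilde
  drad_nu Fdiff_nu.
by rewrite /chern_form /normal_coeff; field; rewrite ?F0 ?r0 ?f0.
Qed.

Lemma g_tilde u w : g v (tilde h W F v u) w = F v / rad v * angular v u w.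
Proof.
by rewrite tildeE// randers_gBl randers_gZl randers_g_self// /randers_g; field;
  rewrite ?F0 ?r0 ?f0.
Qed.

Lemma tilde_tangent u : h (N x) u = 0 -> h (N x) (tilde h W F v u) = 0.
Proof. by move=> Tu; rewrite tildeE// dotDr dotNr dotZr Tu Tv mulr0 subr0. Qed.

(** A vector is determined by its [h]-normal component and its [g v]-products with tangent vectors:
    the difference [d] of two candidates is tangent and [g v]-orthogonal to itself. *)
Lemma chern_vector u e : h (N x) u = 0 -> h (N x) e = - h u v ->
  (forall w, h (N x) w = 0 -> g v e w = - chern_form x v u w) ->
  e = - normal_coeff x v *: tilde h W F v u - h u v *: nu.
Proof.
move=> Tu Ne ge; apply/eqP; rewrite -subr_eq0; apply/eqP.
set d := e - _; have Td : h (N x) d = 0.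
  have E k c s t : h (N x) (e - (- k *: s - c *: t)) =
      h (N x) e + k * h (N x) s + c * h (N x) t.
    by rewrite !(dotDr, dotNr, dotZr); ring.
  by rewrite E tilde_tangent// dot_N_nu Ne; ring.
apply: (randers_g_eq0 v0).
have gd w : h (N x) w = 0 -> g v d w = 0.
  have E k c s t : g v (e - (- k *: s - c *: t)) w =
      g v e w + k * g v s w + c * g v t w by rewrite !(randers_gBl,
        randers_gZl); ring.
  by move=> Tw; rewrite E ge// g_tilde g_nu Tw /chern_form; ring.
exact: gd.
Qed.

(** Partial derivative of [chern_form] in the base point, which enters only through
    [f / (1 - f ^+ 2)]; the quotient in [f] is the derivative of that function, and [- h x' W] the
    variation of the height. *)
Definition chern_form_dx x' y z :=
  h v v * ((1 + f ^+ 2) / (1 - f ^+ 2) ^+ 2) * (- h x' W) * angular v y z /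
    (2 * rad v).

(** Partial derivative of [chern_form] in [v] along [a], with [y] and [z] fixed; the factors [F v]
    of the form cancel beforehand. *)
Definition chern_form_dv a y z := f / (2 * (1 - f ^+ 2)) *
  (2 * h v a * angular v y z / rad v
   - h v v * (angular v a y * drad v z + angular v a z * drad v y) / rad v ^+ 2
   - h v v * angular v y z * drad v a / rad v ^+ 2).

Lemma chern_form_self z : chern_form x v v z = 0.
Proof. by rewrite /chern_form angular_self// mulr0. Qed.

Lemma chern_formC y z : chern_form x v y z = chern_form x v z y.
Proof. by rewrite /chern_form angularC. Qed.

Lemma chern_formDl y y' z : chern_form x v (y + y') z =
  chern_form x v y z + chern_form x v y' z.
Proof. by rewrite /chern_form angularDl mulrDr. Qed.

Lemma chern_formZl c y z : chern_form x v (c *: y) z = c * chern_form x v y z.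
Proof. by rewrite /chern_form angularZl mulrCA. Qed.

Lemma chern_form_dx_self x' z : chern_form_dx x' v z = 0.
Proof. by rewrite /chern_form_dx angular_self//; ring. Qed.

(** This is the identity [chern_form x v v z = 0] differentiated in [v]. *)
Lemma chern_form_dv_self a z : chern_form_dv a v z = - chern_form x v a z.
Proof.
rewrite /chern_form_dv [angular v a v]angularC !angular_self// drad_self//.
by rewrite /chern_form /normal_coeff; field; rewrite ?F0 ?r0 ?f0.
Qed.

Lemma chern_form_dvD a b y z :
  chern_form_dv (a + b) y z = chern_form_dv a y z + chern_form_dv b y z.
Proof. by rewrite /chern_form_dv dotDr !angularDl dradD; ring. Qed.

Lemma chern_form_dvZ c a y z : chern_form_dv (c *: a) y z = c * chern_form_dv a y z.
Proof. by rewrite /chern_form_dv dotZr !angularZl dradZ; ring. Qed.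

End At.

Lemma is_derive_chern_form (x a y z : R -> V) (t : R) (x' a' y' z' : V) :
  S (x t) -> a t != 0 -> is_derive t 1 x x' ->
  is_derive t 1 a a' -> is_derive t 1 y y' -> is_derive t 1 z z' ->
  is_derive t 1 (fun s => chern_form (x s) (a s) (y s) (z s))
    (chern_form_dx (x t) (a t) x' (y t) (z t) + chern_form_dv (x t) (a t) a'
      (y t) (z t)
     + chern_form (x t) (a t) y' (z t) + chern_form (x t) (a t) (y t) z').
Proof.
move=> Sx a0 Dx Da Dy Dz; have rn : rad (a t) != 0 by rewrite gt_eqF// rad_gt0.
have Fn : F (a t) != 0 by rewrite gt_eqF// F_gt0.
have fn : 1 - height (x t) ^+ 2 != 0 by rewrite gt_eqF// height_lt1.
have Df : is_derive t 1 (fun s => height (x s)) (- h x' W).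
  have DN := is_deriveB (is_derive_cst W t 1) Dx.
  have D1 := is_derive_dotr W DN.
  rewrite (_ : (fun s => height _) = (fun s => h ((cst W - x) s) W)); last first.
    by apply/funext => s; rewrite /height /Nvec opprB.
  by apply: (is_derive_eq D1); rewrite sub0r dotNl.
have DF := is_derive_F a0 Da.
have Dr := is_derive_rad a0 Da.
have DT := is_derive_angular a0 Da Dy Dz.
have fn2 : 2 * F (a t) * (1 - height (x t) * height (x t)) != 0.
  by rewrite -expr2 !mulf_neq0// pnatr_eq0.
have Dden := is_derive_mul (is_derive_cmul 2 DF)
  (is_derive_sub (is_derive_cst (1 : R) t 1) (is_derive_mul Df Df)).
have D0 := is_derive_mul (is_derive_mul (is_derive_div (g :=
  fun s => rad (a s)) rn DF Dr)
  (is_derive_div (g := fun s => 2 * F (a s) * (1 - height (x s) * height (x s))) fn2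
    (is_derive_mul (is_derive_dot h fdV Da Da) Df) Dden)) DT.
apply: (is_derive_eq D0).
rewrite /chern_form_dx /chern_form_dv /chern_form /normal_coeff [h a' _]dotC /cst.
move: fn; rewrite expr2 => fn.
by field; rewrite ?rn ?Fn ?fn.
Qed.

(** The algebraic end of the computation. Here [evv], [euv] and [e] stand for [E_v(v, v)],
    [E_v(u, v)] and [E_v(u, u)]; the last is known only through its normal component. *)
Lemma curvature_formula x v u e : S x -> v != 0 -> h (N x) v = 0 -> h (N x) u = 0 ->
  (forall a b : R, a *: u + b *: v = 0 -> a = 0 /\ b = 0) ->
  h (N x) e = - h u u ->
  let evv := - h v v *: g_normal x v in
  let euv := - normal_coeff x v *: tilde h W F v u - h u v *: g_normal x v in
  let v1 := (F v)^-1 *: v in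
  let u1 := tilde h W F v u in
  (chern_form_dx x v v u u - chern_form_dv x v evv u u + g v evv e
    - 2 * chern_form x v u euv - g v euv euv) /
      (F v ^+ 2 * g v u u - g v u v ^+ 2) =
  (1 - height x ^+ 2)^-1 *
      (h v1 v1 - h ((hnorm h u1)^-1 *: u1) v1 ^+ 2
       + h v v / (2 * F v ^+ 3 * (1 - height x ^+ 2))
         * (- h v W * (1 + 3 * height x ^+ 2)
            + 3 / (2 * F v) * height x ^+ 2 * h v v)).
Proof.
move=> Sx v0 Tv Tu uv Ne evv euv v1 u1.
have rn : rad v != 0 by rewrite gt_eqF// rad_gt0.
have Fn : F v != 0 by rewrite gt_eqF// F_gt0.
have fn : 1 - height x ^+ 2 != 0 by rewrite gt_eqF// height_lt1.
have dotWv : h v W = rad v - lam * F v by rewrite /rad addrAC subrr add0r.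
have dotvv : h v v = F v * (2 * rad v - lam * F v).
  by rewrite -F_quadratic dotWv; ring.
(* Linear independence makes [T], the squared [h]-length of [u1], positive; the denominator of the
   flag curvature is [F v ^+ 3 / rad v * T]. *)
have u10 : u1 != 0.
  apply/eqP; rewrite /u1 tildeE// => /eqP;
    rewrite -{1}[u]scale1r -scaleNr => /eqP/uv[/eqP].
  by rewrite oner_eq0.
have Tu1 : h (N x) u1 = 0 by exact: tilde_tangent.
have T0 : 0 < angular v u u by rewrite angularE// dot_gt0.
have Tn : angular v u u != 0 by rewrite gt_eqF.
set T := angular v u u in T0 Tn *.
have T1 : angular v u u1 = T.
  by rewrite angularC /u1 tildeE// angularDl -scaleNr angularZl angular_self//
    mulr0 addr0.
have -> : chern_form x v u euv = - normal_coeff x v ^+ 2 * (F v / rad v) * T.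
  have E k c s t : angular v (- k *: s - c *: t) u =
    - k * angular v s u - c * angular v t u.
    by rewrite angularDl -scaleNr !angularZl; ring.
  by rewrite /chern_form angularC E angular_nu// Tu angularC T1; ring.
have -> : g v euv euv = normal_coeff x v ^+ 2 * (F v / rad v) * T
    + h u v ^+ 2 * (F v / (rad v * (1 - height x ^+ 2))).
  have E k c s t : g v (- k *: s - c *: t) (- k *: s - c *: t) =
      k ^+ 2 * g v s s + 2 * k * c * g v t s + c ^+ 2 * g v t t.
    by rewrite !(randers_gBl, randers_gBr, randers_gZl, randers_gZr) [g v s
      t]randers_gC; ring.
  by rewrite E !g_nu// dot_N_nu// Tu1 g_tilde// T1; ring.
have -> : g v evv e = h v v * h u u * (F v / (rad v * (1 - height x ^+ 2))).
  by rewrite randers_gZl g_nu// Ne; ring.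
have -> : chern_form_dv x v evv u u = - h v v * (height x / (2 *
  (1 - height x ^+ 2)) *
    (2 * (height x / (1 - height x ^+ 2)) * T
     - h v v * T * (height x / (F v * (1 - height x ^+ 2))) / rad v)).
  rewrite chern_form_dvZ /chern_form_dv dot_v_nu// !angular_nu// Tu drad_nu// -/T.
  by field; rewrite ?rn ?Fn ?fn.
have -> : F v ^+ 2 * g v u u - g v u v ^+ 2 = F v ^+ 3 / rad v * T.
  by rewrite [g v u v]randers_gC randers_g_self// /randers_g -/T; ring.
(* With [k = Fdiff v u / F v], this turns [h v v * h u u - h u v ^+ 2] into
   [h v v * T - (h u v - k * h v v) ^+ 2], the source of the first two terms of the formula. *)
have huu : h u u = T + 2 * (Fdiff v u / F v) * h u v -
  (Fdiff v u / F v) ^+ 2 * h v v.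
  rewrite /T angularE// tildeE// !(dotDl, dotDr, dotNl, dotNr, dotZl, dotZr).
  by rewrite [h v u]dotC; ring.
have hu1v : h ((hnorm h u1)^-1 *: u1) v1 ^+ 2 =
    (h u v - Fdiff v u / F v * h v v) ^+ 2 / (T * F v ^+ 2).
  have ET : h u1 u1 = T by rewrite /T angularE.
  have sT : Num.sqrt T ^+ 2 = T by rewrite sqr_sqrtr// ltW.
  have sn : Num.sqrt T != 0 by rewrite gt_eqF// sqrtr_gt0.
  rewrite /hnorm ET dotZl dotZr !exprMn !exprVn sT.
  rewrite {1}/u1 tildeE// dotDl dotNl dotZl.
  by field; rewrite ?Fn ?Tn.
have -> : h v1 v1 = h v v / F v ^+ 2 by rewrite dotZl dotZr; field.
rewrite hu1v huu /chern_form_dx -/T dotvv dotWv /normal_coeff dotvv.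
by field; rewrite ?Tn ?rn ?Fn ?fn.
Qed.

(** * Tangent vectors and tangent fields of the indicatrix *)

Lemma is_derive_N (c : R -> V) (t : R) c' : is_derive t 1 c c' ->
  is_derive t 1 (fun s => N (c s)) (- c').
Proof.
move=> Dc; have D := is_deriveB (is_derive_cst W t 1) Dc.
rewrite (_ : (fun s => _) = cst W - c); last by apply/funext => s;
  rewrite /Nvec opprB.
by apply: (is_derive_eq D); rewrite sub0r.
Qed.

Lemma is_derive_unique (E : normedModType R) (f f' : R -> E) (d d' : E) :
  (\forall t \near (0 : R), f t = f' t) ->
  is_derive (0 : R) 1 f d -> is_derive (0 : R) 1 f' d' -> d = d'.
Proof.
move=> ff' [_ <-] [_ <-]; exact: near_eq_derive.
Qed.

Lemma tangent_dot p w : tangent S p w -> h (N p) w = 0.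
Proof.
move=> [c cpw]; have Dc := curve_is_derive cpw; have [_ Sc c0 _] := cpw.
have DN := is_derive_N Dc; have D := is_derive_dot h fdV DN DN.
have := is_derive_unique _ D (is_derive_cst (1 : R) (0 : R) 1).
rewrite c0 (_ : _ + _ = - 2 * h (N p) w); last first.
  by move: (N p) => n; rewrite dotNl dotNr [h w _]dotC; ring.
move=> E; suff : - 2 * h (N p) w = 0 by lra.
by apply: E; apply: filterS Sc => t /indicatrixP.
Qed.

Let rot (om : R) (a b : V) (t : R) : V := cos (om * t) *: a + sin (om * t) *: b.

Let is_derive_rot om a b (t : R) : is_derive t 1 (rot om a b) (rot om
  (om *: b) (- om *: a) t).
Proof.
have Dm : is_derive t 1 (fun s : R => om * s) om.
  by have D := is_derive_cmul om (is_derive_id t 1); apply: (is_derive_eq D);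
    rewrite mulr1.
have Dc := is_derive1_comp (is_derive_cos (om * t)) Dm.
have Ds := is_derive1_comp (is_derive_sin (om * t)) Dm.
have D := is_deriveD (is_derive_scale Dc (is_derive_cst a t 1))
  (is_derive_scale Ds (is_derive_cst b t 1)).
apply: (is_derive_eq D); rewrite !scaler0 !addr0 /rot addrC !scalerA.
by rewrite mulNr mulrN.
Qed.

(** The family [rot om] is closed under differentiation, so induction on [k] over all [a], [b]
    applies. *)
Let Ck_rot om a b k : Ck k setT (rot om a b : R^o -> V).
Proof.
have dr a' b' t : differentiable (rot om a' b') t.
  by apply/derivable1_diffP; have [] := is_derive_rot om a' b' t.
elim: k a b => [|k IHk] a b.
  by move=> t _; apply: differentiable_continuous; exact: dr.
split=> [t _|v]; first exact: dr.
rewrite (_ : (fun t => _) = rot om (v *: (om *: b)) (v *: (- om *: a))) //.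
apply/funext => t; rewrite (deriveE _ (dr a b t)) -[v in LHS]mulr1.
rewrite -[v * 1]/(v *: (1 : R)) linearZ /= -(deriveE _ (dr a b t)).
have [_ ->] := is_derive_rot om a b t; rewrite /rot scalerDr !scalerA.
by congr (_ *: _ + _ *: _); ring.
Qed.

(** The witness is the great circle of the sphere around [W] through [p] in direction [w], run at
    angular speed [om], the [h]-length of [w]; for [w = 0] it is a constant curve. *)
Lemma dot_tangent p w : S p -> h (N p) w = 0 -> tangent S p w.
Proof.
move=> Sp Nw; have NN := (indicatrixP p).1 Sp.
have [->|w0] := eqVneq w 0.
  exists (cst p); split=> //.
  - by exists setT; split=> [||k]; [exact: openT| |exact: Ck_cst].
  - by apply: filterS filterT => t _; exact: Sp.
  - by rewrite derive1E derive_cst.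
pose om := Num.sqrt (h w w).
have w20 := dot_gt0 h w0.
have om0 : om != 0 by rewrite gt_eqF// sqrtr_gt0.
have om2 : om ^+ 2 = h w w by rewrite sqr_sqrtr// ltW.
pose c : R -> V := cst W + rot om (- N p) (om^-1 *: w).
have cE t : N (c t) = - rot om (- N p) (om^-1 *: w) t.
  by rewrite /Nvec /c -[X in - (X - W)]/(W + _) addrAC subrr add0r.
exists c; split.
- exists setT; split=> [||k]; [exact: openT|by []|].
  by apply: CkD; [exact: openT|exact: Ck_cst|exact: Ck_rot].
- apply: filterS filterT => t _; apply/indicatrixP; rewrite cE.
  have E (x y : R) n : h (- (x *: - n + y *: (om^-1 *: w))) (-
    (x *: - n + y *: (om^-1 *: w))) =
     x ^+ 2 * h n n - 2 * x * y / om * h n w + y ^+ 2 * (h w w / om ^+ 2).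
    by rewrite !dotE [h w n]dotC; field.
  by rewrite E NN Nw om2 mulfV ?gt_eqF// !(mulr0, mulr1) subr0 cos2Dsin2.
- by rewrite /c -[LHS]/(W + _) /rot mulr0 cos0 sin0 scale0r scale1r addr0 /Nvec
  opprK addrC subrK.
- rewrite derive1E; have D := is_deriveD (is_derive_cst W (0 : R) 1)
  (is_derive_rot om (- N p) (om^-1 *: w) 0).
  have [_ ->] := D; rewrite /rot mulr0 cos0 sin0 scale0r scale1r addr0 add0r.
  by rewrite scalerA mulfV// scale1r.
Qed.

(** On the indicatrix [N q] has [h]-length 1, so this is the [h]-orthogonal projection of the
    constant field [w]. It extends tangent vectors to fields, the only arguments the connection
    accepts. *)
Definition tangent_field (w q : V) : V := w - h (N q) w *: N q.

Lemma tangent_field_vfield p w : S p -> vfield_near S p (tangent_field w).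
Proof.
move=> Sp; split; last first.
  apply: filterS filterT => q _ Sq; apply: dot_tangent => //.
  rewrite /tangent_field; have NN := (indicatrixP q).1 Sq.
  have E n : h n (w - h n w *: n) = h n w * (1 - h n n) by rewrite !dotE; ring.
  by rewrite E NN subrr mulr0.
exists (tangent_field w); split; last by apply: filterS filterT => q _.
exists setT; split=> [||k]; [exact: openT|by []|].
have oT := @openT V.
have CN : Ck k setT N.
  by apply: (CkN (f := id - cst W) oT); apply: CkD => //;
    [exact: Ck_id|apply: CkN => //; exact: Ck_cst].
apply: (CkD (g := - (fun q => h (N q) w *: N q)) oT); first exact: Ck_cst.
by apply: CkN => //; apply: CkZ => //; exact: Ck_dot.
Qed.

Lemma tangent_extension p w : S p -> tangent S p w -> local_extension S p w
  (tangent_field w).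
Proof.
move=> Sp /tangent_dot Nw; split; first exact: tangent_field_vfield.
by rewrite /tangent_field Nw scale0r subr0.
Qed.

Lemma vfield_near_near p Y : vfield_near S p Y -> \forall q \near p,
  vfield_near S q Y.
Proof.
move=> [/smooth_along_near sY /near_join tY].
by apply: filterS2 sY tY => q sq tq; split.
Qed.

Lemma vfield_tangent p Y : S p -> vfield_near S p Y -> tangent S p (Y p).
Proof. by move=> Sp [_ /nbhs_singleton]; exact. Qed.

(** The Gauss formula of the unit sphere: differentiate [h (N q) (Y q) = 0] along a curve. *)
Lemma dot_tderive p w Y : S p -> tangent S p w -> vfield_near S p Y ->
  h (N p) (tderive S Y p w) = h w (Y p).
Proof.
move=> Sp tw [sY tY]; have [cpw DY] := tderive_is_derive tw sY.
set c := get _ in cpw DY; have Dc := curve_is_derive cpw; have [_ Sc c0 _] := cpw.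
have D := is_derive_dot h fdV (is_derive_N Dc) DY.
have := is_derive_unique _ D (is_derive_cst (0 : R) (0 : R) 1).
rewrite /= c0 [h (- w) _]dotNl addrC => /(_ _)/subr0_eq; apply.
by apply: filterS2 Sc (curve_near cpw tY) => t Sct /tangent_dot.
Qed.

(** * The Chern connection of the indicatrix *)

Section Connection.
Context (nabla : anisotropic_connection V).
Local Notation L := (fun v => F v ^+ 2).
Hypothesis hnabla : levi_civita_chern S L nabla.
Local Notation nu := g_normal.
Local Notation form := chern_form.
Local Notation kappa := normal_coeff.

(** Allows covariant derivatives to be iterated. [lcc_smooth] is composed with the graph of an
    ambient extension [A'] of [A], which stays nonzero near [p]. *)
Lemma aconn_vfield p A Y Z : S p -> vfield_near S p A -> A p != 0 ->
  vfield_near S p Y -> vfield_near S p Z -> vfield_near S p (aconn nabla A Y Z).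
Proof.
move=> Sp vA A0 vY vZ; have [sA tA] := vA.
have tAp := vfield_tangent Sp vA.
have [A' [U [oU Up CA AA']]] := smooth_alongP sA.
have [g [Q [oQ Qp Cg ng]]] := smooth_alongP (lcc_smooth hnabla Sp tAp A0 vY vZ).
have cA' : {for p, continuous A'} by exact: (CA 0%N).
have A'p : A' p = A p by rewrite AA'.
have nA0 : \forall q \near p, A' q != 0.
  have n0 : 0 < `|A' p| by rewrite normr_gt0 A'p.
  move/cvgrPdist_lt: cA' => /(_ _ n0); apply: filterS => q.
  by apply: contraTN => /eqP ->; rewrite subr0 ltxx.
have nO : \forall q \near p, Q (q, A' q).
  have c2 : (q, A' q) @[q --> p] --> (p, A' p) by apply: cvg_pair;
    [exact: cvg_id|exact: cA'].
  by apply: (c2 Q); rewrite A'p; exact: open_nbhs_nbhs.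
have nU := open_nbhs_nbhs (conj oU Up).
split.
  have : nbhs p [set q | U q /\ Q (q, A' q)] by apply: filterS2 nU nO => q.
  rewrite nbhsE; case=> U' [oU' Up'] U'U.
  exists (fun q => g (q, A' q)); split.
    exists U'; split=> // k; apply: (Ck_comp_graph h fdV oU' _ (Cg k)).
      by move=> q /U'U[].
    by apply: Ck_subset (CA k) => q /U'U[].
  apply: filterS2 (open_nbhs_nbhs (conj oU' Up')) tA => q U'q tAq Sq.
  have [Uq Qq] := U'U _ U'q; rewrite -AA'// in Qq *.
  by apply: (ng (q, A q)) => //; split=> //; exact: tAq.
have nY := vfield_near_near vY; have nZ := vfield_near_near vZ.
have nYZ : \forall q \near p, vfield_near S q Y /\ vfield_near S q Z.
  by apply: filterS2 nY nZ => q.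
have nUA : \forall q \near p, U q /\ A' q != 0 by apply: filterS2 nU nA0 => q.
apply: filterS3 nYZ nUA tA => q [vYq vZq] [Uq A'q] tAq Sq.
by apply: (lcc_tangent hnabla) => //; [exact: tAq|rewrite AA'].
Qed.

Definition second_form p v Y Z := nabla p v Y Z - tderive S Z p (Y p).

Section At.
Context (p v : V).
Hypotheses (Sp : S p) (v0 : v != 0).

Lemma second_form_sym A Y Z : local_extension S p v A ->
  vfield_near S p Y -> vfield_near S p Z ->
  second_form p v Y Z = second_form p v Z Y.
Proof.
move=> [vA Av] vY vZ; have A0 : A p != 0 by rewrite Av.
have := lcc_torsion_free hnabla Sp vA A0 vY vZ; rewrite /aconn /bracket Av => E.
move/eqP: E; rewrite subr_eq /second_form => /eqP ->.
by rewrite addrC !addrA addNr add0r addrC.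
Qed.

Lemma second_form_normal Y Z : tangent S p v -> vfield_near S p Y ->
  vfield_near S p Z ->
  h (N p) (second_form p v Y Z) = - h (Y p) (Z p).
Proof.
move=> tv vY vZ; have tY := vfield_tangent Sp vY.
have t1 := tangent_dot (lcc_tangent hnabla Sp tv v0 vY vZ).
rewrite /second_form [h (N p) (_ - _)]dotDr dotNr t1 add0r.
by rewrite (dot_tderive Sp tY vZ).
Qed.

(** The difference of two almost metric rules, that of the connection and that of the flat
    derivative along the curve representing [X p]. *)
Lemma second_form_metric A X Y Z : local_extension S p v A ->
  vfield_near S p X -> vfield_near S p Y -> vfield_near S p Z ->
  g v (second_form p v X Y) (Z p) + g v (Y p) (second_form p v X Z)
    + 2 * C v (second_form p v X A) (Y p) (Z p) = 0.
Proof.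
move=> [vA Av] vX vY vZ; have A0 : A p != 0 by rewrite Av.
have tX := vfield_tangent Sp vX.
have := lcc_almost_metric hnabla Sp vA A0 vX vY vZ.
rewrite /aconn Av !fund_tensorE// cartan_tensorE//.
have [cX DA] := tderive_is_derive tX (proj1 vA).
have [_ DY] := tderive_is_derive tX (proj1 vY).
have [_ DZ] := tderive_is_derive tX (proj1 vZ).
have [_ _ c0 _] := cX; set c := get _ in cX DA DY DZ c0.
have Ac0 : (A \o c) 0 != 0 by rewrite /= c0.
have D := is_derive_randers_g Ac0 DA DY DZ.
have -> : tderive S (fun q => fund_tensor L (A q) (Y q) (Z q) : R^o) p (X p) =
   2 * C v (tderive S A p (X p)) (Y p) (Z p) + g v (tderive S Y p (X p)) (Z p)
   + g v (Y p) (tderive S Z p (X p)).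
  have [_ D2] := D; move: D2; rewrite /= c0 Av => <-.
  rewrite /tderive -/c derive1E; apply: near_eq_derive.
  by apply: filterS (curve_neq0 DA Ac0) => t At; rewrite /= fund_tensorE.
rewrite /second_form !(randers_gBl, randers_gBr).
rewrite [C v (_ - _) _ _]/randers_C.
rewrite -scaleN1r !angularDl !angularZl /drad_tilde FdiffD dradD FdiffZ dradZ.
rewrite /randers_C /drad_tilde => E; lra.
Qed.

(** In both instances of almost metricity the Cartan term has [v] among its arguments and vanishes.
    The derivative along [Z] gives [g_v(v, E_v(Z, v)) = 0], which by symmetry removes the second
    term of the derivative along [A]. *)
Lemma second_form_v (A Z : V -> V) : local_extension S p v A -> vfield_near S p Z ->
  g v (second_form p v A A) (Z p) = 0.
Proof.
move=> eA vZ; have [vA Av] := eA.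
have M1 := second_form_metric eA vA vA vZ.
have M2 := second_form_metric eA vZ vA vA.
rewrite Av in M1 M2; rewrite randers_C_self2// in M1;
  rewrite randers_C_self2// in M2.
rewrite [second_form p v Z A](second_form_sym eA)// [g v v _]randers_gC in M2.
rewrite [g v v _]randers_gC in M1; lra.
Qed.

Lemma second_form_vvE A : local_extension S p v A ->
  second_form p v A A = - h v v *: nu p v.
Proof.
move=> eA; have [vA Av] := eA; have tv : tangent S p v by rewrite -Av;
  exact: vfield_tangent.
have Tv := tangent_dot tv.
have := chern_vector Sp v0 Tv (u := v) (e := second_form p v A A) Tv.
rewrite second_form_normal// Av tildeE// Fdiff_self// mulfV ?gt_eqF ?F_gt0//.
rewrite scale1r subrr scaler0 sub0r scaleNr; apply=> // w Tw.
rewrite chern_form_self// oppr0.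
have tw := dot_tangent Sp Tw.
by have [vZ <-] := tangent_extension Sp tw; exact: second_form_v.
Qed.

(* Koszul's trick: combine three permutations of almost metricity. *)
Lemma second_form_v_g A X Z : local_extension S p v A ->
  vfield_near S p X -> vfield_near S p Z ->
  g v (second_form p v X A) (Z p) = - form p v (X p) (Z p) /\
  g v v (second_form p v X Z) = form p v (X p) (Z p).
Proof.
move=> eA vX vZ; have [vA Av] := eA.
have tv : tangent S p v by rewrite -Av; exact: vfield_tangent.
have M1 := second_form_metric eA vX vA vZ.
have M2 := second_form_metric eA vZ vX vA.
have M3 := second_form_metric eA vA vX vZ.
rewrite Av in M1 M2 M3; rewrite randers_C_self2// in M1;
  rewrite randers_C_self3// in M2.
rewrite [second_form p v Z X](second_form_sym eA)//
  [second_form p v Z A](second_form_sym eA)// in M2.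
rewrite second_form_vvE// in M3.
have Tv := tangent_dot tv.
have TX := tangent_dot (vfield_tangent Sp vX).
have TZ := tangent_dot (vfield_tangent Sp vZ).
rewrite C_nu// [second_form p v A X](second_form_sym eA)// in M3.
rewrite [g v (second_form p v X Z) v]randers_gC in M2.
split; lra.
Qed.

Lemma second_formE A X : local_extension S p v A -> vfield_near S p X ->
  second_form p v X A = - kappa p v *: tilde h W F v (X p) - h (X p) v *: nu p v.
Proof.
move=> eA vX; have [vA Av] := eA; have tv : tangent S p v by rewrite -Av;
  exact: vfield_tangent.
apply: (chern_vector Sp v0).
- exact: (tangent_dot tv).
- exact: (tangent_dot (vfield_tangent Sp vX)).
- by rewrite second_form_normal// Av.
- move=> w Tw; have tw := dot_tangent Sp Tw.
  have [vZ <-] := tangent_extension Sp tw.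
  by have [] := second_form_v_g eA vX vZ.
Qed.

(** Valid at every base point and every nonzero tangent [v], so it can be differentiated in both;
    the curvature needs nothing more about [nabla p v Y Z] for general [Y], [Z] than this and its
    normal component. *)
Lemma g_nabla Y Z : tangent S p v -> vfield_near S p Y -> vfield_near S p Z ->
  g v v (nabla p v Y Z) = g v v (tderive S Z p (Y p)) + form p v (Y p) (Z p).
Proof.
move=> tv vY vZ; have eA := tangent_extension Sp tv.
have [_ <-] := second_form_v_g eA vY vZ.
by rewrite /second_form randers_gBr addrC subrK.
Qed.

End At.
Local Notation dx := chern_form_dx.
Local Notation dv := chern_form_dv.
Local Notation E := second_form.

(** * Curvature *)

Lemma vfield_neq0 p A : vfield_near S p A -> A p != 0 ->
  S p -> \forall q \near p, S q -> A q != 0.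
Proof.
move=> [sA _] A0 Sp.
have [A' [U [oU Up CA AA']]] := smooth_alongP sA.
have cA' : {for p, continuous A'} by exact: (CA 0%N).
have n0 : 0 < `|A' p| by rewrite normr_gt0 -AA'.
move/cvgrPdist_lt: cA' => /(_ _ n0); apply: filterS2 (open_nbhs_nbhs
  (conj oU Up)) => q Uq + Sq.
by rewrite (AA' q)//; apply: contraTN => /eqP ->; rewrite subr0 ltxx.
Qed.

(* The bracket is smooth and tangent because torsion-freeness writes it as a
   difference of two covariant derivatives. *)
Lemma bracket_vfield p A X Y : S p -> vfield_near S p A -> A p != 0 ->
  vfield_near S p X -> vfield_near S p Y -> vfield_near S p (bracket S X Y).
Proof.
move=> Sp vA A0 vX vY.
have nA : \forall q \near p, vfield_near S q A /\ (S q -> A q != 0).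
  by apply: filterS2 (vfield_near_near vA) (vfield_neq0 vA A0 Sp) => q.
have tor : \forall q \near p, S q ->
    (aconn nabla A X Y - aconn nabla A Y X) q = bracket S X Y q.
  apply: filterS3 nA (vfield_near_near vX) (vfield_near_near vY) =>
    q [vAq Aq] vXq vYq Sq.
  by rewrite -(lcc_torsion_free hnabla Sq vAq (Aq Sq) vXq vYq).
have [s1 t1] := aconn_vfield Sp vA A0 vX vY.
have [s2 t2] := aconn_vfield Sp vA A0 vY vX.
split; first exact: smooth_along_ext tor (smooth_alongB s1 s2).
apply: filterS3 tor t1 t2 => q torq t1q t2q Sq; rewrite -(torq Sq).
apply: (dot_tangent Sq); rewrite -[(_ - _) q]/(_ q - _ q) [h (N q)
  (_ - _)]dotDr dotNr.
by rewrite (tangent_dot (t1q Sq)) (tangent_dot (t2q Sq)) subrr.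
Qed.

Section At.
Context (p v : V) (A : V -> V).
Hypotheses (Sp : S p) (v0 : v != 0) (eA : local_extension S p v A).

Let vA : vfield_near S p A. Proof. by case: eA. Qed.
Let Av : A p = v. Proof. by case: eA. Qed.
Let A0 : A p != 0. Proof. by rewrite Av. Qed.
Let tv : tangent S p v. Proof. by rewrite -Av; exact: vfield_tangent. Qed.

(** [g_nabla] for [Y], [Z] and reference field [A] is differentiated along a curve representing
    [X p], then applied once more to [X] and the field [nabla^A_Y Z]. Cartan terms vanish because
    [A] fills one of their slots. *)
Lemma g_second_covariant X Y Z Z' U : vfield_near S p X -> vfield_near S p Y ->
  vfield_near S p Z -> open U -> U p -> Ck 2 U Z' ->
    (forall q, U q -> S q -> Z q = Z' q) ->
  g v v (nabla p v X (aconn nabla A Y Z)) =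
    g v v ('D_(tderive S Y p (X p)) Z' p + 'D_(X p) (fun x => 'D_(Y p) Z' x) p)
    - g v (tderive S A p (X p)) (E p v Y Z)
    + dx p v (X p) (Y p) (Z p) + dv p v (tderive S A p (X p)) (Y p) (Z p)
    + form p v (tderive S Y p (X p)) (Z p) + form p v (Y p) (tderive S Z p (X p))
    + form p v (X p) (nabla p v Y Z).
Proof.
move=> vX vY vZ oU Up CZ ZZ'; have tX := vfield_tangent Sp vX.
have vB := aconn_vfield Sp vA A0 vY vZ; set B := aconn nabla A Y Z in vB *.
have Bp : B p = nabla p v Y Z by rewrite /B /aconn Av.
rewrite (g_nabla Sp v0 tv vX vB) Bp.
have [cX DB] := tderive_is_derive tX (proj1 vB).
have [_ DA] := tderive_is_derive tX (proj1 vA).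
have [_ DY] := tderive_is_derive tX (proj1 vY).
have [_ DZ] := tderive_is_derive tX (proj1 vZ).
have Dc := curve_is_derive cX; have [_ Sc c0 _] := cX.
set c := get _ in cX DB DA DY DZ Dc Sc c0.
have Ac0 : (A \o c) 0 != 0 by rewrite /= c0.
have DDZ := is_derive_derive_curve h fdV oU Up CZ c0 Dc DY.
have Sc0 : S (c 0) by rewrite c0.
have D1 := is_derive_randers_g Ac0 DA DA DB.
have D2 := is_derive_add (is_derive_randers_g Ac0 DA DA DDZ)
  (is_derive_chern_form Sc0 Ac0 Dc DA DY DZ).
have dZ' q : U q -> differentiable Z' q by have [dZ' _] := CZ; exact: dZ'.
have tZ q : U q -> S q -> vfield_near S q Y -> tderive S Z q (Y q) = 'D_(Y q) Z' q.
  move=> Uq Sq vYq; apply: tderive_eq (dZ' q Uq); first exact: vfield_tangent.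
  by apply: filterS (open_nbhs_nbhs (conj oU Uq)) => r Ur Sr; exact: ZZ'.
have nq : \forall q \near p, S q ->
    g (A q) (A q) (B q) = g (A q) (A q) ('D_(Y q) Z' q) + form q (A q) (Y q) (Z q).
  have n1 : \forall q \near p, vfield_near S q A /\ (S q -> A q != 0).
    by apply: filterS2 (vfield_near_near vA) (vfield_neq0 vA A0 Sp) => q.
  have n2 : \forall q \near p, U q /\ vfield_near S q Y.
    by apply: filterS2 (open_nbhs_nbhs (conj oU Up)) (vfield_near_near vY) => q.
  apply: filterS3 n1 n2 (vfield_near_near vZ) => q [vAq Aq] [Uq vYq] vZq Sq.
  rewrite -tZ// /B /aconn; apply: g_nabla => //; first exact: Aq.
  exact: vfield_tangent.
have := is_derive_unique (curve_near cX nq) D1 D2.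
rewrite /= c0 Av !randers_C_self2// Bp mulr0 !add0r /second_form [tderive S Z p
  (Y p)]tZ// !randers_gBr.
lra.
Qed.

(** [g_nabla] differentiated in [v] along the line [v + t *: w] at the fixed point [p]; tangency of
    [w] keeps the line in the tangent space. *)
Lemma g_vertical_derivative Y Z w : vfield_near S p Y -> vfield_near S p Z ->
  tangent S p w ->
  g v v (vertical_derivative nabla p v Y Z w) =
    dv p v w (Y p) (Z p) - g v w (E p v Y Z).
Proof.
move=> vY vZ tw.
have tl (t : R) : tangent S p (v + t *: w).
  apply: (dot_tangent Sp).
  by rewrite [h (N p) _]dotDr dotZr (tangent_dot tv) (tangent_dot tw) mulr0 addr0.
have Dl := is_derive_shift_line v w.
have v00 : v + (0 : R) *: w != 0 by rewrite scale0r addr0.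
have Dn : is_derive (0 : R) 1 (fun t : R => nabla p (v + t *: w) Y Z)
    (vertical_derivative nabla p v Y Z w).
  rewrite /vertical_derivative derive1E; apply: derivableP.
  have [k [Q [oQ Qp Ck nk]]] := smooth_alongP (lcc_smooth hnabla Sp tv v0 vY vZ).
  have dk : differentiable k (p, v + (0 : R) *: w).
    by rewrite scale0r addr0; have [dk _] := Ck 1%N; exact: dk.
  have dl : differentiable (fun t : R => (p, v + t *: w)) 0.
    apply: differentiable_pair; first exact: differentiable_cst.
    by apply/derivable1_diffP; have [] := Dl.
  have nQ : \forall t \near (0 : R), Q (p, v + t *: w).
    have cl : {for (0 : R), continuous (fun t : R => (p, v + t *: w))}.
      exact: differentiable_continuous dl.
    apply: (cl Q); rewrite /= scale0r addr0.
    exact: open_nbhs_nbhs.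
  apply: (@near_eq_derivable _ _ _ (k \o (fun t : R => (p, v + t *: w)))).
    by apply: filterS nQ => t Qt; rewrite /= -nk//; split; [exact: Sp|exact: tl].
  by apply/derivable1_diffP; exact: differentiable_comp.
have D1 := is_derive_randers_g v00 Dl Dl Dn.
have D2 := is_derive_add
  (is_derive_randers_g v00 Dl Dl (is_derive_cst (tderive S Z p (Y p)) (0 : R) 1))
  (is_derive_chern_form (x := cst p) Sp v00 (is_derive_cst p (0 : R) 1) Dl
    (is_derive_cst (Y p) (0 : R) 1) (is_derive_cst (Z p) (0 : R) 1)).
have nq : \forall t \near (0 : R),
    g (v + t *: w) (v + t *: w) (nabla p (v + t *: w) Y Z) =
    g (v + t *: w) (v + t *: w) (tderive S Z p (Y p)) + form p (v + t *: w)
      (Y p) (Z p).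
  apply: filterS (near_line w v0) => t vt.
  exact: g_nabla.
have := is_derive_unique nq D1 D2.
have g0 z : g v z 0 = 0 by rewrite -(scale0r 0) randers_gZr mul0r.
have f0 z : form p v 0 z = 0 by rewrite -(scale0r 0) chern_formZl mul0r.
have x0 y z : dx p v 0 y z = 0 by rewrite /chern_form_dx dot0l oppr0 mulr0 !mul0r.
rewrite scale0r addr0 /cst !randers_C_self2//
  mulr0 !add0r /second_form randers_gBr g0 f0 x0.
rewrite [form p v (Y p) 0]chern_formC f0; lra.
Qed.

(** The vertical derivatives are taken along [nabla_X A] and [nabla_Y A]; their parts along [D_X A]
    and [D_Y A] cancel the derivatives of [A] left by the second covariant derivatives, and the
    bracket term absorbs those of [X] and [Y]. Only values of [second_form] remain. *)
Lemma g_chern_curvature u X Y Z : local_extension S p v X ->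
  local_extension S p u Y -> local_extension S p u Z ->
  g v (chern_curvature S nabla A X Y Z p) v =
  dx p v v u u - dv p v (E p v X X) u u + g v (E p v X X) (E p v Y Z)
  - 2 * form p v u (E p v X Z) - g v (E p v X Z) (E p v X Z).
Proof.
move=> [vX Xv] [vY Yu] [vZ Zu].
have vbr := bracket_vfield Sp vA A0 vX vY.
have [Z' [U [oU Up CZ ZZ']]] := smooth_alongP (proj1 vZ).
have CZ2 := CZ 2%N.
have tbr := vfield_tangent Sp vbr.
have dZ' : differentiable Z' p by have [dZ' _] := CZ2; exact: dZ'.
have tZ w : tangent S p w -> tderive S Z p w = 'D_w Z' p.
  move=> tw; apply: tderive_eq => //.
  by apply: filterS (open_nbhs_nbhs (conj oU Up)) => r Ur Sr; exact: ZZ'.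
have tu : tangent S p u by rewrite -Yu; exact: vfield_tangent.
have tXA := lcc_tangent hnabla Sp tv v0 vX vA.
have tYA := lcc_tangent hnabla Sp tv v0 vY vA.
have tX : tangent S p (X p) by rewrite Xv.
have tY : tangent S p (Y p) by rewrite Yu.
(* The explicit formula of [second_formE] shows that only the values at [p] matter when one argument
   extends [v]. *)
have eXA : E p v X A = E p v X X.
  rewrite (second_formE Sp v0 eA vX).
  by rewrite (second_formE Sp v0 (conj vX Xv) vX).
have eYA : E p v Y A = E p v X Z.
  rewrite (second_formE Sp v0 eA vY) Yu -Zu.
  rewrite -(second_formE Sp v0 (conj vX Xv) vZ).
  exact: (second_form_sym Sp v0 (conj vX Xv)).
have nE Y1 Z1 : nabla p v Y1 Z1 = tderive S Z1 p (Y1 p) + E p v Y1 Z1.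
  by rewrite /second_form addrC subrK.
have T1 := g_second_covariant vX vY vZ oU Up CZ2 ZZ'.
have T2 := g_second_covariant vY vX vZ oU Up CZ2 ZZ'.
have T3 := g_nabla Sp v0 tv vbr vZ.
have P1 := g_vertical_derivative vY vZ tXA.
have P2 := g_vertical_derivative vX vZ tYA.
rewrite randers_gC /chern_curvature /affine_curvature /aconn Av randers_gDr [g
  v v (_ - vertical_derivative _ _ _ _ _ _)]randers_gBr.
rewrite P1 P2 [g v v (_ - nabla p v (bracket _ _ _) _)]randers_gBr T3.
rewrite [g v v (nabla _ _ _ _ - nabla _ _ _ _)]randers_gBr T1 T2.
rewrite (tZ _ tbr) (tZ _ tX) (tZ _ tY) (derive_sym h fdV _ _ oU Up CZ2).
rewrite (nE X A) (nE Y A) (nE X Z) eXA eYA (tZ _ tX) /bracket Xv Yu Zu.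
set Y' := tderive S Y p v; set X' := tderive S X p u.
have -> : 'D_(Y' - X') Z' p = 'D_Y' Z' p - 'D_X' Z' p.
  by rewrite !(deriveE _ dZ') linearB.
(* All vectors become variables: what remains is linear algebra in the forms. *)
clearbody X' Y'; move: (E p v X X) (E p v X Z) (E p v Y Z) => eXX eXZ eYZ.
move: (tderive S A p v) (tderive S A p u) => Av' Au'.
move: ('D_Y' Z' p) ('D_X' Z' p) ('D_v Z' p) ('D_u _ p) => DY DX Dv DuDv.
rewrite !chern_form_dvD !(chern_form_dv_self Sp v0) (chern_form_dx_self p v0).
rewrite !(chern_form_self p v0) -[- X']scaleN1r chern_formDl chern_formZl.
rewrite ![form p v u _]chern_formC chern_formDl randers_gBr !randers_gDr
  !randers_gDl.
Show.
by ring.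
Qed.

End At.
End Connection.

End RandersMinkowski.

Theorem corollary20 (R : realType) (V : normedModType R)
    (fdV : finite_dimensional V) (h : {dot V for idfun}) (W : V)
    (hW : h W W < 1) (F : V -> R) (hF : zermelo_norm h W F)
    (nabla : anisotropic_connection V)
    (hnabla : levi_civita_chern (indicatrix F) (fun v => F v ^+ 2) nabla)
    (x v u : V) (hx : indicatrix F x)
    (hv : tangent (indicatrix F) x v) (hv0 : v != 0)
    (hu : tangent (indicatrix F) x u)
    (huv : forall a b : R, a *: u + b *: v = 0 -> a = 0 /\ b = 0) :
  let N := Nvec W x in
  let v1 := (F v)^-1 *: v in
  let u1 := tilde h W F v u in
  is_flag_curvature (indicatrix F) (fun v => F v ^+ 2) nabla x v u
    ((1 - h N W ^+ 2)^-1 *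
      (h v1 v1 - h ((hnorm h u1)^-1 *: u1) v1 ^+ 2
       + h v v / (2 * F v ^+ 3 * (1 - h N W ^+ 2))
         * (- h v W * (1 + 3 * h N W ^+ 2)
            + 3 / (2 * F v) * h N W ^+ 2 * h v v))).
Proof.
move=> N v1 u1.
have Nv := tangent_dot fdV hW hF hv; have Nu := tangent_dot fdV hW hF hu.
split.
- by exists (tangent_field h W v); exact: (tangent_extension fdV hW hF hx hv).
- by exists (tangent_field h W u); exact: (tangent_extension fdV hW hF hx hu).
move=> A X Y Z eA eX eY eZ.
rewrite !(fund_tensorE fdV hW hF)//.
rewrite (g_chern_curvature fdV hW hF hnabla hx hv0 eA eX eY eZ).
have [vX Xv] := eX; have [vY Yu] := eY; have [vZ Zu] := eZ.
rewrite (second_form_vvE fdV hW hF hnabla hx hv0 eX).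
(* Symmetry moves [X], the extension of [v], into the second slot, where [second_formE] applies. *)
rewrite (second_form_sym hnabla hx hv0 eX vX vZ).
rewrite (second_formE fdV hW hF hnabla hx hv0 eX vZ) Zu.
have Ne := second_form_normal fdV hW hF hnabla hx hv0 hv vY vZ.
rewrite Yu Zu in Ne.
by rewrite (curvature_formula hW hF hx hv0 Nv Nu huv Ne).
Qed.
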